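(* Assume that $f_\star$ belongs to the KL support of $\Pi$ and that, for some $0<\alpha<\beta<\infty$, the posterior is $(\alpha,\beta)$-inconsistent. Then there exists $\gamma\in[\alpha,\beta]$ such that, for all sufficiently small $\chi>0$, one can find $\mu_1,\mu_2\ge0$ with $\mu_1+\mu_2\le\chi$ such that, for all $\tau_1,\tau_2>0$, with positive $F_\star^\infty$-probability the inequalities $$\gamma-\mu_1-\tau_1\ \le\ -n^{-1}\ln\Pi\big(\big\{f\in\mathbb F:\gamma-\mu_1\le n^{-1}\ln R_n(f)\le\gamma+\mu_2\big\}\big)\ \le\ \gamma+\mu_2+\tau_2$$ hold for infinitely many $n\in\mathbb N$.
   Context: Setting. $\mathbb X$ is a separable metric space with Borel $\sigma$-algebra $\mathscr X$, $\lambda$ is a $\sigma$-finite measure on it, and $\mathbb F$ is a family of probability densities with respect to $\lambda$ (densities being identified with the distributions they define), equipped with the Borel $\sigma$-algebra $\mathscr F$ of the topology of weak convergence of probability measures. The map $(x,f)\mapsto f(x)$ is jointly measurable on $\mathbb X\times\mathbb F$. $X_1,X_2,\dots$ are iid $\mathbb X$-valued random elements with distribution $F_\star$ having density $f_\star$ with respect to $\lambda$. All probability statements are under the infinite product measure $F_\star^\infty$. The prior $\Pi$ is a probability measure on $(\mathbb F,\mathscr F)$. The likelihood ratio is $R_n(f):=\prod_{i=1}^n f(X_i)/f_\star(X_i)$, and the posterior distributions are $$\Pi(\mathrm df\mid X_{1:n})=\frac{R_n(f)\,\Pi(\mathrm df)}{\int_{\mathbb F}R_n(g)\,\Pi(\mathrm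 dg)},\qquad n\in\mathbb N.$$ The usual convention $\ln 0=-\infty$ is in force. KL support. $\mathrm{KL}(f,g):=\int_{\mathbb X} f\ln(f/g)\,\mathrm d\lambda$. A density $f_\star\in\mathbb F$ belongs to the KL support of $\Pi$ if $\Pi(\{f\in\mathbb F:\mathrm{KL}(f_\star,f)<\delta\})>0$ for all $\delta>0$. $(\alpha,\beta)$-inconsistency. For $0<\alpha\le\beta<\infty$, the posterior is $(\alpha,\beta)$-inconsistent if there exists $\delta>0$ such that $$F_\star^\infty\Big(\Pi(\{f\in\mathbb F:e^{\alpha n}\le R_n(f)\le e^{\beta n}\}\mid X_{1:n})>\delta\ \text{ for infinitely many } n\Big)>0.$$ *)

(* Defs.v *)
From HB Require Import structures.
From mathcomp Require Export all_boot all_order all_algebra finmap.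
From mathcomp Require Export all_classical all_reals all_analysis.

Set Implicit Arguments.
Unset Strict Implicit.
Unset Printing Implicit Defensive.
Import Order.TTheory GRing.Theory Num.Theory.
Import numFieldNormedType.Exports.
Local Open Scope classical_set_scope.
Local Open Scope ring_scope.

(* A measurable space has to be pointed in the library, hence so does the
   metric space that carries the Borel sigma-algebra. *)
#[short(type="pmetricType")]
HB.structure Definition PMetric (R : numDomainType) :=
  {T of Pointed T & Metric R T}.

Notation borel T := (g_sigma_algebraType (@open T)).

Definition separable (T : topologicalType) : Prop :=
  exists2 D : set T, countable D & dense D.

Section densities.
Context {R : realType} {X : pmetricType R}.
Variable lambda : {sigma_finite_measure set (borel X) -> \bar R}.

Definition prob_density (f : X -> R) : Prop :=
  [/\ measurable_fun [set: borel X] f, (forall x, 0 <= f x) &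
      (\int[lambda]_(x in [set: borel X]) (f x)%:E = 1)%E].

(* In the extended reals 0^-1 = +oo, lne 0 = -oo and 0 * +oo = 0 * -oo = 0, so
   the integrand is 0 where f = 0, and +oo where f > 0 = g. *)
Definition KL (f g : X -> R) : \bar R :=
  (\int[lambda]_(x in [set: borel X])
     ((f x)%:E * lne ((f x)%:E / (g x)%:E)))%E.

(* The type of the members of [F]; [fstar] only serves to point it. *)
Definition family (F : set (X -> R)) (fstar : set_type F) : Type := set_type F.

HB.instance Definition _ (F : set (X -> R)) (fstar : set_type F) :=
  Choice.copy (family fstar) (set_type F).
HB.instance Definition _ (F : set (X -> R)) (fstar : set_type F) :=
  isPointed.Build (family fstar) fstar.

Definition density_of (F : set (X -> R)) (fstar : set_type F)
  (f : family fstar) : X -> R := sval f.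

Definition bounded_continuous : Type :=
  {g : X -> R | continuous g /\ bounded_fun g}.

(* The integrals of all bounded continuous functions with respect to the
   distribution whose density is [f]. As a map into the product space
   R^bounded_continuous, it induces on the family the topology of weak
   convergence of probability measures. *)
Definition weak_integrals (F : set (X -> R)) (fstar : set_type F)
    (f : family fstar) : {ptws bounded_continuous -> R} :=
  fun g => \int[lambda]_(x in [set: borel X]) (sval g x * density_of f x).

Definition weak_open (F : set (X -> R)) (fstar : set_type F) :
    set (set (family fstar)) :=
  @open (initial_topology (@weak_integrals F fstar)).

End densities.

Coercion density_of : family >-> Funclass.

Notation weak_borel lambda fstar :=
  (g_sigma_algebraType (@weak_open _ _ lambda _ fstar)).

(* Every set of the Borel sigma-algebra of the weak topology is a union of
   classes of lambda-a.e. equality. Joint measurability makes the maps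
   f |-> f x measurable for this sigma-algebra, so that no two distinct members
   of the family are lambda-a.e. equal. *)
Definition jointly_measurable {R : realType} {X : pmetricType R}
    (lambda : {sigma_finite_measure set (borel X) -> \bar R})
    (F : set (X -> R)) (fstar : set_type F) : Prop :=
  measurable_fun [set: borel X * weak_borel lambda fstar]
    (fun z => @density_of R X F fstar z.2 z.1).

Section iid.
Context {R : realType} {X : pmetricType R}.
Context {d : measure_display} {Omega : measurableType d}.
Variables (P : probability Omega R) (Xs : nat -> {RV P >-> borel X}).

Definition mutually_independent : Prop :=
  forall (J : {fset nat}) (A : nat -> set (borel X)),
    (forall i, measurable (A i)) ->
    P (\bigcap_(i in [set` J]) (Xs i @^-1` A i)) =
    (\big[*%E/1%E]_(i <- J) P (Xs i @^-1` A i))%E.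

(* The law of [Xs] on the sequence space is then the infinite product of the
   distribution with density [f]. *)
Definition iid_with_density
    (lambda : {sigma_finite_measure set (borel X) -> \bar R}) (f : X -> R) :=
  mutually_independent /\
  forall i (A : set (borel X)), measurable A ->
    distribution P (Xs i) A = (\int[lambda]_(x in A) (f x)%:E)%E.

End iid.

Section posterior.
Context {R : realType} {X : pmetricType R}.
Variables (lambda : {sigma_finite_measure set (borel X) -> \bar R})
  (F : set (X -> R)) (fstar : set_type F)
  (Pi : probability (weak_borel lambda fstar) R).

Definition KL_support : Prop :=
  forall delta : R, 0 < delta ->
    (0 < Pi [set f : family fstar |
               (KL lambda (sval fstar) f < delta%:E)%E])%E.

(* [x i] is the observation number i + 1. The value of the quotient when
   fstar (x i) = 0 is irrelevant: under fstar this is a null event. *)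
Definition likelihood_ratio (x : nat -> X) (n : nat) (f : family fstar) : R :=
  \prod_(i < n) (f (x i) / sval fstar (x i)).

(* The quotient is taken in the extended reals. The denominator has expectation
   at most 1, hence is almost surely finite. *)
Definition posterior (x : nat -> X) (n : nat) (A : set (family fstar)) :
    \bar R :=
  ((\int[Pi]_(f in A) (likelihood_ratio x n f)%:E) /
   (\int[Pi]_f (likelihood_ratio x n f)%:E))%E.

Context {d : measure_display} {Omega : measurableType d}.
Variables (P : probability Omega R) (Xs : nat -> {RV P >-> borel X}).

Definition inconsistent (alpha beta : R) : Prop :=
  exists2 delta : R, 0 < delta &
    (0 < P [set w | infinite_set [set n : nat |
       (delta%:E < posterior (fun i => Xs i w) n
          [set f | (expR (alpha * n%:R) <=
                    likelihood_ratio (fun i => Xs i w) n f <=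
                    expR (beta * n%:R))%R])%E]])%E.

End posterior.

(* Main.v *)
Require Import Defs.
From mathcomp Require Import ring lra.
From mathcomp Require Import measurable_realfun.

(** Write D_n for the evidence, the integral of R_n with respect to the prior,
    and Inc(a, b) for inconsistency on the band e^(an) <= R_n <= e^(bn).

    The posterior mass of a band is (integral of R_n over the band) / D_n, and
    on the band R_n is between e^(an) and e^(bn). So when that posterior mass
    exceeds a constant, the prior mass of the band is between e^(-bn) and
    e^(-an) up to a factor D_n and constants. The evidence is subexponential in
    both directions, almost surely and for all large n. It is at most e^(eps n)
    because its expectation is at most 1 ([ae_evidence_le]); it is at least
    e^(-eps n) because fstar is in the Kullback-Leibler support
    ([ae_evidence_ge]). Hence the prior mass is pinned as required, up to
    arbitrarily small tau1 and tau2, infinitely often on the event of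
    inconsistency ([heavy_io_pinned]).

    It remains to make the band short. Inc passes to larger bands, and when a
    band is cut in two, Inc holds on one of the pieces, with half the threshold.
    Such a property concentrates at a point gamma, around which Inc holds on
    every neighbourhood ([concentration_point]). Symmetric bands
    mu1 = mu2 = chi / 2 then work for every chi > 0.

    The lower bound on the evidence is usually drawn from the strong law of
    large numbers for ln (fstar / f). A bound up to a constant factor on sums of
    nonnegative iid variables is enough ([ae_sum_iid_le]), because the mean of
    the positive part of ln (fstar / f) alone is small when the divergence is
    small ([integral_pos_log_ratio_le]). That bound comes from Chebyshev's
    inequality for the variables truncated at 2^k over blocks of length 2^k,
    and from Borel-Cantelli.

    A measure is unconstrained outside the measurable sets, so every event whose
    probability occurs is shown to be measurable, by Tonelli's theorem. *)

Set Implicit Arguments.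
Unset Strict Implicit.
Unset Printing Implicit Defensive.
Import Order.TTheory GRing.Theory Num.Theory.
Import numFieldNormedType.Exports.
Local Open Scope classical_set_scope.
Local Open Scope ring_scope.

(** * Extending identities from indicators to functions *)

Section weighted_integral.
Local Open Scope ereal_scope.
Context d d' (T : measurableType d) (S : measurableType d') (R : realType).
Variables (mu : {measure set T -> \bar R}) (nu : {measure set S -> \bar R}).
Variables (Y : T -> S) (Z : T -> R) (c : R).
Hypotheses (mY : measurable_fun setT Y) (mZ : measurable_fun setT Z).
Hypothesis Z0 : forall t, (0 <= Z t)%R.
Hypothesis weighted_indic : forall A, measurable A ->
  \int[mu]_t ((Z t)%:E * (\1_A (Y t))%:E) = c%:E * nu A.

Import HBNNSimple.

(** The identity assumed on indicators extends by linearity to simple functions,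
    then by monotone convergence to nonnegative measurable functions. This one
    extension serves to change variables ([Z] constant), to integrate against a
    density ([mu] the reference measure, [Z] the density, [Y] the identity), and
    to pull one factor out of an expectation of independent factors ([Z] the
    product of the others). *)
Lemma integral_weighted_nnsfun (h : {nnsfun S >-> R}) :
  \int[mu]_t ((Z t)%:E * (h (Y t))%:E) = c%:E * \int[nu]_x (h x)%:E.
Proof.
transitivity (\int[mu]_t (\sum_(r \in range h)
    (r%:E * ((Z t)%:E * (\1_(h @^-1` [set r]) (Y t))%:E)))).
  apply: eq_integral => t _; rewrite [in LHS]fimfunE -fsumEFin//.
  rewrite ge0_mule_fsumr//; last first.
    by move=> r; rewrite EFinM nnfun_muleindic_ge0.
  by apply: eq_fsbigr => r _; rewrite EFinM muleCA.
have mi r : measurable_fun setT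
    (EFin \o ((\1_(h @^-1` [set r]) : S -> R) \o Y)).
  by apply/measurable_EFinP; apply: measurableT_comp.
have mZE : measurable_fun setT (EFin \o Z) by exact/measurable_EFinP.
rewrite ge0_integral_fsum//; last 2 first.
- by move=> r; apply: measurable_funeM; exact: (emeasurable_funM mZE (mi r)).
- move=> r t _; rewrite muleCA mule_ge0 ?lee_fin//.
  by rewrite -lee_fin EFinM nnfun_muleindic_ge0.
transitivity (\sum_(r \in range h) (c%:E * (r%:E * nu (h @^-1` [set r])))).
  apply: eq_fsbigr => r; rewrite inE => -[x _ <-].
  rewrite ge0_integralZl ?lee_fin//; last first.
  - by move=> t _; rewrite mule_ge0// lee_fin.
  - exact: (emeasurable_funM mZE (mi (h x))).
  by rewrite weighted_indic// muleCA.
rewrite -ge0_mule_fsumr; last first.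
  move=> r; case: (leP 0%R r) => r0; first by rewrite mule_ge0.
  by rewrite preimage_nnfun0// measure0 mule0.
congr (_ * _); under [RHS]eq_integral do rewrite fimfunE -fsumEFin//.
rewrite ge0_integral_fsum //; last 2 first.
- by move=> r; exact/measurable_EFinP/measurable_funM.
- by move=> r x _; rewrite EFinM nnfun_muleindic_ge0.
apply: eq_fsbigr => r; rewrite inE => -[x _ <-].
under eq_integral do rewrite EFinM.
by rewrite ge0_integralZl ?lee_fin// ?integral_indic ?setIT//;
  exact/measurable_EFinP.
Qed.

Lemma integral_weighted (g : S -> \bar R) :
  measurable_fun setT g -> (forall x, 0 <= g x) ->
  \int[mu]_t ((Z t)%:E * g (Y t)) = c%:E * \int[nu]_x g x.
Proof.
move=> mg g0.
have mZE : measurable_fun setT (EFin \o Z) by exact/measurable_EFinP.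
pose h := nnsfun_approx measurableT mg.
have cvgh x : (h n x)%:E @[n --> \oo] --> g x by exact: cvg_nnsfun_approx.
have mh n : measurable_fun setT (fun t => (h n (Y t))%:E).
  by apply/measurable_EFinP; exact: measurableT_comp.
have L : \int[mu]_t ((Z t)%:E * (h n (Y t))%:E) @[n --> \oo] -->
    \int[mu]_t ((Z t)%:E * g (Y t)).
  rewrite [X in _ --> X](_ : _ =
      \int[mu]_t limn (fun n => (Z t)%:E * (h n (Y t))%:E)).
    apply: cvg_monotone_convergence => //.
    - by move=> n; exact: (emeasurable_funM mZE (mh n)).
    - by move=> n t _; rewrite mule_ge0// lee_fin.
    - move=> t _ m n mn; rewrite lee_wpmul2l ?lee_fin//.
      exact/lefP/nd_nnsfun_approx.
  apply: eq_integral => t _; apply/esym/cvg_lim => //.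
  exact: cvgeZl.
have L' : \int[mu]_t ((Z t)%:E * (h n (Y t))%:E) @[n --> \oo] -->
    c%:E * \int[nu]_x g x.
  under eq_fun do rewrite integral_weighted_nnsfun.
  apply: cvgeZl => //.
  rewrite [X in _ --> X](_ : _ = \int[nu]_x limn (fun n => (h n x)%:E)).
    apply: cvg_monotone_convergence => //.
    - by move=> n; exact/measurable_EFinP.
    - by move=> n x _; rewrite lee_fin.
    - by move=> x _ m n mn; rewrite lee_fin; exact/lefP/nd_nnsfun_approx.
  by apply: eq_integral => x _; apply/esym/cvg_lim.
by rewrite -(cvg_lim _ L)// -(cvg_lim _ L').
Qed.

End weighted_integral.

(** * Events that occur infinitely often *)

Section borel_cantelli_ae.
Local Open Scope ereal_scope.
Context d (T : measurableType d) (R : realType).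
Variable mu : {measure set T -> \bar R}.

Lemma ae_eventually_not (B : (set T)^nat) : (forall n, measurable (B n)) ->
  \sum_(n <oo) mu (B n) < +oo ->
  {ae mu, forall w, \forall n \near \oo, ~ B n w}.
Proof.
move=> mB Boo; exists (lim_sup_set B); split.
- by apply: bigcap_measurable => // n _; exact: bigcup_measurable.
- exact: lim_sup_set_cvg0.
- move=> w /= nw n _; apply: contrapT => nB; apply: nw.
  by exists n => // j /= nj Bj; apply: nB; exists j.
Qed.

Lemma ge0_markov (f : T -> \bar R) (B : set T) (a : R) : measurable B ->
  measurable_fun setT f -> (forall x, 0 <= f x) -> (0 <= a)%R ->
  (forall x, B x -> a%:E <= f x) -> a%:E * mu B <= \int[mu]_x f x.
Proof.
move=> mB mf f0 a0 af; rewrite -integral_cst//.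
apply: (@le_trans _ _ (\int[mu]_(x in B) f x)).
  apply: ge0_le_integral => //.
  exact: measurable_funTS.
exact: ge0_subset_integral.
Qed.

End borel_cantelli_ae.

Section infinitely_often.
Context (T : Type).
Implicit Types A B : (set T)^nat.

Lemma lim_sup_setP A w :
  lim_sup_set A w <-> forall n, exists2 k, (n <= k)%N & A k w.
Proof.
split=> [Aw n|Aw n _]; first by have [k nk Ak] := Aw n I; exists k.
by have [k nk Ak] := Aw n; exists k.
Qed.

Lemma infinitely_oftenE A :
  [set w | infinite_set [set n | A n w]] = lim_sup_set A.
Proof.
apply/seteqP; split=> w /=.
  move=> Aw; apply/lim_sup_setP => n; apply: contrapT => An; apply: Aw.
  apply: (@sub_finite_set _ _ `I_n); last exact: finite_II.
  move=> k /= Ak; rewrite ltnNge; apply/negP => nk.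
  by apply: An; exists k.
move=> /lim_sup_setP Aw /finite_seqP[s sE].
have [k sk Ak] := Aw (\max_(i <- s) i).+1.
have : [set` s] k by rewrite -sE.
move=> /= ks; have := leq_bigmax_seq (P := xpredT) (F := id) k ks isT.
by move=> /(leq_trans sk); rewrite ltnn.
Qed.

Lemma lim_sup_setU_sub A B C : (forall n, C n `<=` A n `|` B n) ->
  lim_sup_set C `<=` lim_sup_set A `|` lim_sup_set B.
Proof.
move=> CAB w /lim_sup_setP Cw.
have [Aw|nA] := pselect (lim_sup_set A w); [by left|right].
move/lim_sup_setP/existsNP : nA => [N nA].
apply/lim_sup_setP => n; have [k + /CAB[Ak|Bk]] := Cw (maxn N n).
  by rewrite geq_max => /andP[Nk _]; exfalso; apply: nA; exists k.
by rewrite geq_max => /andP[_ nk]; exists k.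
Qed.

Lemma sub_lim_sup_set A B : (forall n, A n `<=` B n) ->
  lim_sup_set A `<=` lim_sup_set B.
Proof.
move=> AB w /lim_sup_setP Aw; apply/lim_sup_setP => n.
by have [k nk /AB Bk] := Aw n; exists k.
Qed.

End infinitely_often.

Lemma measurable_lim_sup_set d (T : measurableType d) (A : (set T)^nat) :
  (forall n, measurable (A n)) -> measurable (lim_sup_set A).
Proof.
by move=> mA; apply: bigcap_measurable => // n _; exact: bigcup_measurable.
Qed.

(** * Sums of independent nonnegative variables *)

Section dyadic_sums.
Context (R : realFieldType).
Implicit Types v : R.

(** The series in which the tail and the truncated second moment of a
    nonnegative variable are summed over dyadic blocks, here and in
    [sum_pow2_ge]. Both are geometric, hence of the order of their extreme term,
    at the largest power of 2 below [v] and at the first one above it. The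
    auxiliary bounds in the inductions keep track of that term. *)
Lemma sum_pow2_lt v K : 0 <= v ->
  \sum_(k < K) 2 ^+ k * (2 ^+ k < v)%R%:R <= 2 * v.
Proof.
move=> v0.
apply: (@proj1 _ (\sum_(k < K) 2 ^+ k * (2 ^+ k < v)%R%:R <= 2 ^+ K)).
elim: K => [|K [h1 h2]]; first by rewrite !big_ord0 expr0; split; lra.
rewrite big_ord_recr/= exprS; move: (exprn_gt0 K (ltr0n R 2 : 0 < 2%:R :> R)).
by move=> K0; case: (ltP (2 ^+ K) v) => vK; rewrite ?mulr1 ?mulr0; split; lra.
Qed.

Lemma sum_pow2_ge v K : 0 <= v ->
  \sum_(k < K) 2 ^- k * (v ^+ 2 * (v <= 2 ^+ k)%R%:R) <= 2 * v.
Proof.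
move=> v0.
set S := fun K => \sum_(k < K) 2 ^- k * (v ^+ 2 * (v <= 2 ^+ k)%R%:R).
have [h1 h2] : (v <= 2 ^+ K -> S K + 2 * (2 ^- K * v ^+ 2) <= 2 * v) /\
    (2 ^+ K < v -> S K = 0); last first.
  have [/h1|/h2] := leP v (2 ^+ K); last by rewrite /S => ->; lra.
  by apply: le_trans; rewrite lerDl mulr_ge0// mulr_ge0 ?sqr_ge0.
elim: K => [|K [h1 h2]].
  by rewrite expr0 invr1 /S big_ord0; split => // v1; rewrite expr2; nra.
have SS : S K.+1 = S K + 2 ^- K * (v ^+ 2 * (v <= 2 ^+ K)%R%:R).
  by rewrite /S big_ord_recr.
have K0 : (0 : R) < 2 ^+ K by rewrite exprn_gt0.
have e : 2 * (2 ^- K.+1 * v ^+ 2) = 2 ^- K * v ^+ 2 :> R.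
  by rewrite exprS; field; rewrite gt_eqF.
rewrite e SS; have [vK|vK] := leP v (2 ^+ K).
  split; first by move=> _; have := h1 vK; rewrite mulr1; lra.
  by rewrite exprS; lra.
rewrite (h2 vK) mulr0 mulr0 add0r; split => //; rewrite exprS => h.
have : 2 ^- K * v <= 2 by rewrite mulrC ler_pdivrMr// mulrC.
by move=> h'; rewrite expr2 mulrA add0r ler_wpM2r.
Qed.

End dyadic_sums.

Section iid_sequence.
Local Open Scope ereal_scope.
Context d d' (Omega : measurableType d) (T : measurableType d') (R : realType).
Variables (P : probability Omega R) (Xs : nat -> {RV P >-> T}).
Variable Q : probability T R.
Hypothesis law : forall i A, measurable A -> P (Xs i @^-1` A) = Q A.
Hypothesis indep : forall n (A : nat -> set T), (forall i, measurable (A i)) ->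
  P [set w | forall i : 'I_n, A i (Xs i w)] = \prod_(i < n) Q (A i).

Lemma integral_iid1 i (g : T -> \bar R) :
  measurable_fun setT g -> (forall x, 0 <= g x) ->
  \int[P]_w g (Xs i w) = \int[Q]_x g x.
Proof.
move=> mg g0; have := @integral_weighted _ _ _ _ R P Q (Xs i) (cst 1%R) 1.
move=> /(_ _ _ _ _ g mg g0); rewrite mul1e => <- //.
  by apply: eq_integral => w _; rewrite mul1e.
move=> A mA; rewrite mul1e; transitivity (P (Xs i @^-1` A)); last exact: law.
under eq_integral do rewrite mul1e.
rewrite (_ : (fun _ => _) = EFin \o \1_(Xs i @^-1` A)).
  rewrite integral_indic ?setIT// -[X in measurable X]setTI.
  exact: measurable_funPT.
by apply/funext => w; rewrite /= !indicE.
Qed.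

(** Expectations of products factor: [indep] is the case where every factor is
    an indicator. The induction on [k] replaces the indicators of the first [k]
    factors by arbitrary functions, one at a time: with the other factors
    fixed, both sides are integrals of the factor that changes against a
    measure, and these measures agree by the previous step. *)
Lemma integral_iid_prod n (g : nat -> T -> R) :
  (forall i, measurable_fun setT (g i)) -> (forall i x, (0 <= g i x)%R) ->
  (forall i, \int[Q]_x (g i x)%:E < +oo) ->
  \int[P]_w (\prod_(i < n) g i (Xs i w))%:E =
  \prod_(i < n) \int[Q]_x (g i x)%:E.
Proof.
suff H k : forall g : nat -> T -> R,
    (forall i, measurable_fun setT (g i)) -> (forall i x, (0 <= g i x)%R) ->
    (forall i, \int[Q]_x (g i x)%:E < +oo) ->
    (forall i, (k <= i < n)%N -> exists2 A, measurable A & g i = \1_A) ->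
    \int[P]_w (\prod_(i < n) g i (Xs i w))%:E =
    \prod_(i < n) \int[Q]_x (g i x)%:E.
  move=> mg g0 goo; apply: (H n) => // i.
  by case/andP => /leq_ltn_trans h /h; rewrite ltnn.
elim: k => [|k IH] {}g mg g0 goo gind.
  have /choice[A mA] : forall i, exists A, measurable A /\
      ((i < n)%N -> g i = \1_A).
    move=> i; have [ni|ni] := ltnP i n; last by exists set0; split.
    by have [A mA gA] := gind i ni; exists A; split.
  rewrite (eq_integral (EFin \o \1_[set w | forall i : 'I_n, A i (Xs i w)])).
    rewrite integral_indic//; last first.
      rewrite (_ : mkset _ = \bigcap_(i in [set: 'I_n]) (Xs i @^-1` A i)).
        apply: fin_bigcap_measurable => // i _.
        by rewrite -[X in measurable X]setTI;
          apply: measurable_funPT; have [] := mA i.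
      by apply/seteqP; split => [w h i _|w h i]; [exact: h|exact: (h i I)].
    rewrite setIT; transitivity (\prod_(i < n) Q (A i)).
      by apply: indep => i; have [] := mA i.
    apply: eq_bigr => i _; have [mAi ->] := mA i => //.
    by rewrite integral_indic// setIT.
  move=> w _ /=; congr EFin; rewrite indicE.
  have [|/negP] := boolP (_ \in _).
    rewrite inE /= => h; rewrite big1// => i _.
    by have [_ ->] := mA i => //; rewrite indicE mem_set//; exact: h.
  rewrite inE => /existsNP[i hi]; rewrite (bigD1 i)//=.
  by have [_ ->] := mA i => //; rewrite indicE memNset// mul0r.
have [kn|nk] := ltnP k n; last first.
  apply: IH => // i /andP[ki ni].
  by have := leq_trans ni (leq_trans nk ki); rewrite ltnn.
pose k' := Ordinal kn.
(* The weight for the extension from indicators, and its expectation. *)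
pose Z w := (\prod_(i < n | i != k') g i (Xs i w))%R.
pose c := \prod_(i < n | i != k') \int[Q]_x (g i x)%:E.
have cfin : c \is a fin_num.
  rewrite /c; apply: prode_fin_num => i _; rewrite ge0_fin_numE//.
  by apply: integral_ge0 => x _; rewrite lee_fin.
have mXg i : measurable_fun setT (fun w => g i (Xs i w)).
  exact: measurableT_comp.
rewrite (bigD1 k')//= -/c muleC -(fineK cfin).
rewrite -(@integral_weighted _ _ _ _ R P Q (Xs k) Z)//.
- apply: eq_integral => w _; rewrite -EFinM; congr EFin.
  by rewrite (bigD1 k')//= mulrC.
- rewrite /Z; under eq_fun do rewrite -big_filter.
  exact: measurable_prod.
- by move=> w; apply: prodr_ge0.
- move=> A mA; rewrite fineK//.
  pose g' i := if i == k then \1_A : T -> R else g i.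
  have g'k : g' k = \1_A by rewrite /g' eqxx.
  have g'E i : i != k -> g' i = g i by rewrite /g' => /negbTE ->.
  transitivity (\int[P]_w (\prod_(i < n) g' i (Xs i w))%:E).
    apply: eq_integral => w _; rewrite -EFinM; congr EFin.
    rewrite (bigD1 k')//= g'k mulrC; congr (_ * _)%R.
    by apply: eq_bigr => i ik; rewrite g'E.
  rewrite (IH g'); first last.
  + move=> i /andP[ki ni]; rewrite /g'.
    case: eqVneq => [_|ik]; first by exists A.
    by apply: gind; rewrite ltn_neqAle eq_sym ik ki.
  + move=> i; rewrite /g'; case: eqVneq => // _.
    rewrite integral_indic// setIT.
    by rewrite (le_lt_trans (probability_le1 Q mA))// ltey.
  + by move=> i x; rewrite /g'; case: eqVneq.
  + by move=> i; rewrite /g'; case: eqVneq.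
  rewrite (bigD1 k')//= g'k integral_indic// setIT muleC; congr (_ * _).
  by apply: eq_bigr => i ik; rewrite g'E.
- exact/measurable_EFinP.
- by move=> x; rewrite lee_fin.
Qed.

Lemma integral_iid2 i j (a b : T -> R) : i != j ->
  measurable_fun setT a -> measurable_fun setT b ->
  (forall x, (0 <= a x)%R) -> (forall x, (0 <= b x)%R) ->
  \int[Q]_x (a x)%:E < +oo -> \int[Q]_x (b x)%:E < +oo ->
  \int[P]_w (a (Xs i w) * b (Xs j w))%:E =
  \int[Q]_x (a x)%:E * \int[Q]_x (b x)%:E.
Proof.
move=> ij ma mb a0 b0 aoo boo.
have Q1 : \int[Q]_x (cst 1%R x)%:E = 1.
  by rewrite (integral_cst Q measurableT 1) mul1e; exact: probability_setT.
pose n := (maxn i j).+1.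
have ni : (i < n)%N by rewrite ltnS leq_maxl.
have nj : (j < n)%N by rewrite ltnS leq_maxr.
pose g m := if m == i then a else if m == j then b else cst 1%R.
have gi : g i = a by rewrite /g eqxx.
have gj : g j = b by rewrite /g eq_sym (negbTE ij) eqxx.
have := @integral_iid_prod n g.
rewrite (bigD1 (Ordinal ni))//= (bigD1 (Ordinal nj))/=; last first.
  by rewrite -val_eqE eq_sym.
rewrite big1 ?mule1; last first.
  move=> m; rewrite -!val_eqE/= => /andP[mi mj]; rewrite /g ifN//.
  by rewrite ifN.
rewrite gi gj => <-.
- apply: eq_integral => w _; congr EFin.
  rewrite (bigD1 (Ordinal ni))//= (bigD1 (Ordinal nj))/=; last first.
    by rewrite -val_eqE eq_sym.
  rewrite big1 ?mulr1.
    by rewrite gi gj.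
  move=> m; rewrite -!val_eqE/= => /andP[mi mj]; rewrite /g ifN//.
  by rewrite ifN.
- by move=> m; rewrite /g; case: ifP => // _; case: ifP.
- by move=> m x; rewrite /g; case: ifP => // _; case: ifP => /=.
- move=> m; rewrite /g; case: ifP => // _; case: ifP => // _.
  by rewrite Q1 ltey.
Qed.

(** Chebyshev's inequality. To stay with integrals of nonnegative functions, the
    variance is reached through the identity
    (S - E S)^2 + 2 (E S) S = S^2 + (E S)^2. *)
Lemma chebyshev_iid_sum (v : T -> R) (N : nat) (m s c : R) :
  measurable_fun setT v -> (forall x, 0 <= v x)%R ->
  \int[Q]_x (v x)%:E <= m%:E -> \int[Q]_x (v x ^+ 2)%:E = s%:E ->
  (0 < N)%N -> (0 < c)%R ->
  P [set w | (N%:R * (m + c) < \sum_(i < N) v (Xs i w))%R] <=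
  (s / (N%:R * c ^+ 2))%:E.
Proof.
move=> mv v0 vm vs N0 c0.
set B := [set w | _]; pose S w := (\sum_(i < N) v (Xs i w))%R.
have mvX i : measurable_fun setT (fun w => v (Xs i w)).
  exact: measurableT_comp.
have mS : measurable_fun setT S by exact: measurable_sum.
have S0 w : (0 <= S w)%R by exact: sumr_ge0.
have mB : measurable B.
  rewrite -[B]setTI.
  exact: (measurable_fun_ltr (measurable_cst _) mS measurableT).
have v_ge0 : 0 <= \int[Q]_x (v x)%:E.
  by apply: integral_ge0 => x _; rewrite lee_fin.
have [e ve] : exists e, \int[Q]_x (v x)%:E = e%:E.
  exists (fine (\int[Q]_x (v x)%:E)); rewrite fineK// ge0_fin_numE//.
  exact: le_lt_trans vm (ltey _).
have e0 : (0 <= e)%R by rewrite -lee_fin -ve.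
have em : (e <= m)%R by rewrite -lee_fin -ve.
have N_gt0 : (0 < N%:R :> R)%R by rewrite ltr0n.
have ES : \int[P]_w (S w)%:E = (N%:R * e)%:E.
  under eq_integral do rewrite -sumEFin.
  rewrite ge0_integral_sum//; last 2 first.
  - by move=> i; exact/measurable_EFinP.
  - by move=> i w _; rewrite lee_fin.
  under eq_bigr => i _.
    rewrite (@integral_iid1 i (EFin \o v))//; last exact/measurable_EFinP.
    rewrite ve; over.
  by rewrite sumEFin sumr_const card_ord mulr_natl.
have ESS : \int[P]_w (S w ^+ 2)%:E <= (N%:R * s + (N%:R * e) ^+ 2)%:E.
  have -> : \int[P]_w (S w ^+ 2)%:E =
      \sum_(i < N) \sum_(j < N) \int[P]_w (v (Xs i w) * v (Xs j w))%:E.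
    under eq_integral do rewrite expr2 /S mulr_suml -sumEFin.
    rewrite ge0_integral_sum//; last 2 first.
    - by move=> i; apply/measurable_EFinP; exact: measurable_funM.
    - by move=> i w _; rewrite lee_fin mulr_ge0// sumr_ge0.
    apply: eq_bigr => i _.
    under eq_integral do rewrite mulr_sumr -sumEFin.
    rewrite ge0_integral_sum//.
    - by move=> j; apply/measurable_EFinP; exact: measurable_funM.
    - by move=> j w _; rewrite lee_fin mulr_ge0.
  have -> : (N%:R * s + (N%:R * e) ^+ 2 =
      \sum_(i < N) (s + \sum_(j < N) e ^+ 2))%R.
    rewrite !sumr_const !card_ord -[(e ^+ 2 *+ N)%R]mulr_natl.
    by rewrite -[in RHS]mulr_natl; ring.
  rewrite -sumEFin; apply: lee_sum => i _.
  rewrite (bigD1 i)//= EFinD.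
  apply: leeD.
    under eq_integral do rewrite -expr2.
    rewrite (@integral_iid1 i (fun x => (v x ^+ 2)%:E)) ?vs//.
    - by apply/measurable_EFinP; exact: measurable_funX.
    - by move=> x; rewrite lee_fin sqr_ge0.
  apply: (@le_trans _ _ (\sum_(j < N | j != i) (e ^+ 2)%:E)).
    apply: lee_sum => j ji.
    by rewrite integral_iid2// 1?eq_sym// ve ?ltry// -EFinM.
  by rewrite sumEFin lee_fin [leRHS](bigD1 i)//= lerDr sqr_ge0.
have VS : \int[P]_w ((S w - N%:R * e) ^+ 2)%:E <= (N%:R * s)%:E.
  have h : \int[P]_w ((S w - N%:R * e) ^+ 2)%:E + (2 * (N%:R * e) ^+ 2)%:E
      = \int[P]_w (S w ^+ 2)%:E + ((N%:R * e) ^+ 2)%:E.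
    have -> : (2 * (N%:R * e) ^+ 2)%:E =
        \int[P]_w ((2 * (N%:R * e))%:E * (S w)%:E).
      rewrite ge0_integralZl_EFin ?ES//.
      - by rewrite -EFinM; congr EFin; ring.
      - by move=> w _; rewrite lee_fin.
      - exact/measurable_EFinP.
      - by rewrite !mulr_ge0.
    have -> : ((N%:R * e) ^+ 2)%:E = \int[P]_w (cst ((N%:R * e) ^+ 2)%:E w).
      rewrite integral_cst// [X in _ * X](_ : _ = 1) ?mule1//.
      exact: probability_setT.
    rewrite -!ge0_integralD//.
    - by apply: eq_integral => w _; rewrite -!EFinM -!EFinD; congr EFin; ring.
    - by move=> w _; rewrite lee_fin sqr_ge0.
    - by apply/measurable_EFinP; exact: measurable_funX.
    - by move=> w _; rewrite lee_fin sqr_ge0.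
    - by move=> w _; rewrite lee_fin sqr_ge0.
    - by apply/measurable_EFinP; apply: measurable_funX; exact: measurable_funB.
    - by move=> w _; rewrite -EFinM lee_fin !mulr_ge0.
    - by apply/measurable_EFinP; apply: measurable_funM.
  have : \int[P]_w ((S w - N%:R * e) ^+ 2)%:E + (2 * (N%:R * e) ^+ 2)%:E <=
      (N%:R * s)%:E + (2 * (N%:R * e) ^+ 2)%:E.
    rewrite h; apply: (le_trans (leeD ESS (lexx _))); rewrite -!EFinD lee_fin.
    by rewrite le_eqVlt; apply/orP; left; apply/eqP; ring.
  by rewrite leeD2rE.
have : ((N%:R * c) ^+ 2)%:E * P B <= (N%:R * s)%:E.
  apply: le_trans VS; apply: ge0_markov => //.
  - by apply/measurable_EFinP; apply: measurable_funX; exact: measurable_funB.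
  - by move=> w; rewrite lee_fin sqr_ge0.
  - exact: sqr_ge0.
  - move=> w; rewrite /B/= -/(S w) lee_fin => h.
    have h1 : (N%:R * c <= S w - N%:R * e)%R.
      by have : (N%:R * e <= N%:R * m)%R; [rewrite ler_pM2l|]; lra.
    by rewrite ler_sqr// nnegrE ?(le_trans _ h1)// mulr_ge0// ltW.
have PBfin : P B \is a fin_num by exact: fin_num_measure.
rewrite -(fineK PBfin) -EFinM !lee_fin => h.
rewrite ler_pdivlMr ?mulr_gt0 ?exprn_gt0//.
rewrite -(ler_pM2l N_gt0); apply: le_trans h.
by rewrite le_eqVlt; apply/orP; left; apply/eqP; ring.
Qed.

Section dyadic_blocks.
Variables (z : T -> \bar R) (m c : R).
Hypotheses (mz : measurable_fun setT z) (z0 : forall x, 0 <= z x).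
Hypothesis zm : \int[Q]_x z x <= m%:E.
Hypothesis c0 : (0 < c)%R.

(** Over the first [2 ^ k] observations, [z] is cut at the common level [2 ^ k]:
    the truncated variables stay identically distributed. *)
Definition truncation k x : R :=
  (fine (z x) * (z x <= (2 ^+ k)%:E)%E%:R)%R.

(** Pointwise integrand of the bound on the probability of [bad_block k]: the
    first term pays for an observation above the truncation level, the second
    one for Chebyshev's inequality on the truncated sum. *)
Definition block_cost k x : R :=
  (2 ^+ k * ((2 ^+ k)%:E < z x)%E%:R +
   c ^- 2 * (2 ^- k * truncation k x ^+ 2))%R.

Definition bad_block k : set Omega :=
  [set w | (2 ^+ k * (m + c))%:E < \sum_(i < 2 ^ k) z (Xs i w)].

Lemma truncation_ge0 k x : (0 <= truncation k x)%R.
Proof. by rewrite mulr_ge0// fine_ge0. Qed.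

Lemma truncation_le k x : (truncation k x)%:E <= z x.
Proof.
rewrite /truncation; case: (leP (z x) (2 ^+ k)%:E) => [h|_]; last first.
  by rewrite mulr0.
by rewrite mulr1 fineK// ge0_fin_numE// (le_lt_trans h)// ltry.
Qed.

Lemma truncation_le_pow k x : (truncation k x <= 2 ^+ k)%R.
Proof.
rewrite /truncation; case: (leP (z x) (2 ^+ k)%:E) => [h|_]; last first.
  by rewrite mulr0 exprn_ge0.
by rewrite mulr1 -lee_fin fineK// ge0_fin_numE// (le_lt_trans h)// ltry.
Qed.

Lemma measurable_truncation k : measurable_fun setT (truncation k).
Proof.
apply: measurable_funM; first exact: measurableT_comp.
apply: (measurableT_comp (f := fun b : bool => b%:R : R)) => //.
exact: measurable_fun_lee.
Qed.

Lemma spread_cost_ge0 k x : (0 <= c ^- 2 * (2 ^- k * truncation k x ^+ 2))%R.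
Proof.
apply: mulr_ge0; first by rewrite invr_ge0 exprn_ge0// ltW.
by apply: mulr_ge0; [rewrite invr_ge0 exprn_ge0|exact: sqr_ge0].
Qed.

Lemma block_cost_ge0 k x : (0 <= block_cost k x)%R.
Proof.
by rewrite addr_ge0 ?spread_cost_ge0// mulr_ge0// exprn_ge0.
Qed.

Lemma measurable_block_cost k : measurable_fun setT (block_cost k).
Proof.
apply: measurable_funD; apply: measurable_funM => //.
  apply: (measurableT_comp (f := fun b : bool => b%:R : R)) => //.
  exact: measurable_fun_lte.
apply: measurable_funM => //; apply: measurable_funX.
exact: measurable_truncation.
Qed.

(** Summability over [k] is where integrability of [z], rather than of its
    square, suffices. *)
Lemma sum_block_cost x :
  \sum_(k <oo) (block_cost k x)%:E <= (2 + 2 * c ^- 2)%:E * z x.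
Proof.
have C0 : (0 < 2 + 2 * c ^- 2 :> R)%R.
  by rewrite addr_gt0// mulr_gt0// invr_gt0 exprn_gt0.
have [zf|] := boolP (z x \is a fin_num); last first.
  rewrite ge0_fin_numE// -leNgt leye_eq => /eqP ->.
  by rewrite gt0_muley ?lte_fin// leey.
apply: lime_le.
  by apply: is_cvg_nneseries => k _ _; rewrite lee_fin block_cost_ge0.
apply: nearW => K; rewrite sumEFin big_mkord -(fineK zf) -EFinM lee_fin.
rewrite big_split/= -mulr_sumr mulrDl; apply: lerD.
  apply: (le_trans _ (sum_pow2_lt K (fine_ge0 (z0 x)))).
  by apply: ler_sum => k _; rewrite -lte_fin fineK.
rewrite [leRHS](_ : _ = c ^- 2 * (2 * fine (z x)))%R; last by ring.
rewrite ler_wpM2l ?invr_ge0 ?exprn_ge0 ?(ltW c0)//.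
apply: (le_trans _ (sum_pow2_ge K (fine_ge0 (z0 x)))).
apply: ler_sum => k _; rewrite /truncation -[in leRHS]lee_fin fineK// exprMn.
by case: (leP (z x) (2 ^+ k)%:E) => _; rewrite ?expr1n// expr0n.
Qed.

Lemma measurable_bad_block k : measurable (bad_block k).
Proof.
rewrite -[bad_block k]setTI; apply: emeasurable_fun_o_infty => //.
by apply: emeasurable_sum => i; exact: measurableT_comp.
Qed.

Lemma bad_block_le k : P (bad_block k) <= \int[Q]_x (block_cost k x)%:E.
Proof.
have p0 : (0 < 2 ^+ k :> R)%R by rewrite exprn_gt0.
have pN : ((2 ^ k)%N%:R = 2 ^+ k :> R)%R by rewrite natrX.
pose E i := Xs i @^-1` [set x | (2 ^+ k)%:E < z x].
have mzk : measurable [set x | (2 ^+ k)%:E < z x].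
  by rewrite -[X in measurable X]setTI; exact: emeasurable_fun_o_infty.
have mE i : measurable (E i).
  by rewrite -[X in measurable X]setTI; exact: measurable_funPT.
pose B := [set w | ((2 ^ k)%N%:R * (m + c) <
  \sum_(i < 2 ^ k) truncation k (Xs i w))%R].
have mS : measurable_fun setT
    (fun w => \sum_(i < 2 ^ k) truncation k (Xs i w))%R.
  apply: measurable_sum => i; apply: measurableT_comp => //.
  exact: measurable_truncation.
have mB : measurable B.
  rewrite -[B]setTI.
  exact: (measurable_fun_ltr (measurable_cst _) mS measurableT).
have sub : bad_block k `<=` (\big[setU/set0]_(i < 2 ^ k) E i) `|` B.
  move=> w wbad; have [wE|wE] := pselect (exists i : 'I_(2 ^ k), E i w).
    by left; rewrite -bigcup_mkord; case: wE => i Ei; exists i => /=.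
  right; rewrite /B/= -lte_fin pN; apply: (lt_le_trans wbad).
  rewrite -sumEFin; apply: lee_sum => i _; rewrite /truncation.
  have h : z (Xs i w) <= (2 ^+ k)%:E.
    by rewrite leNgt; apply/negP => h; apply: wE; exists i.
  by rewrite h mulr1 fineK// ge0_fin_numE// (le_lt_trans h)// ltry.
have sqfin : \int[Q]_x (truncation k x ^+ 2)%:E \is a fin_num.
  rewrite ge0_fin_numE; last first.
    by apply: integral_ge0 => x _; rewrite lee_fin sqr_ge0.
  apply: (@le_lt_trans _ _ (\int[Q]_x (cst ((2 ^+ k) ^+ 2)%:E x))).
    apply: ge0_le_integral => //.
    - by move=> x _; rewrite lee_fin sqr_ge0.
    - apply/measurable_EFinP; apply: measurable_funX.
      exact: measurable_truncation.
    - move=> x _; rewrite lee_fin ler_sqr ?nnegrE ?truncation_ge0 ?exprn_ge0//.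
      exact: truncation_le_pow.
  rewrite integral_cst// [X in _ * X](_ : _ = 1) ?mule1 ?ltey//.
  exact: probability_setT.
apply: (@le_trans _ _ (P ((\big[setU/set0]_(i < 2 ^ k) E i) `|` B))).
  apply: le_measure => //; rewrite ?inE.
  - exact: measurable_bad_block.
  - by apply: measurableU => //; apply: bigsetU_measurable.
have mUE : measurable (\big[setU/set0]_(i < 2 ^ k) E i).
  exact: bigsetU_measurable.
apply: (le_trans (measureU2 P mUE mB)).
under eq_integral do rewrite EFinD.
rewrite ge0_integralD//; last 3 first.
- apply/measurable_EFinP; apply: measurable_funM => //.
  apply: (measurableT_comp (f := fun b : bool => b%:R : R)) => //.
  exact: measurable_fun_lte.
- by move=> x _; rewrite lee_fin spread_cost_ge0.
- apply/measurable_EFinP; do 2 apply: measurable_funM => //.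
  by apply: measurable_funX; exact: measurable_truncation.
apply: leeD.
  apply: (le_trans (Boole_inequality _ _)) => //.
  rewrite (eq_bigr (fun=> Q [set x | (2 ^+ k)%:E < z x])); last first.
    by move=> i _; exact: law.
  under eq_integral do rewrite EFinM.
  rewrite ge0_integralZl_EFin//; last first.
    apply/measurable_EFinP.
    apply: (measurableT_comp (f := fun b : bool => b%:R : R)) => //.
    exact: measurable_fun_lte.
  rewrite (_ : (fun _ => _) =
      EFin \o \1_[set x | (2 ^+ k)%:E < z x]); last first.
    by apply/funext => x; rewrite /= indicE mem_setE.
  rewrite integral_indic// setIT.
  by rewrite sumr_const card_ord -pN mule_natl.
have tm : \int[Q]_x (truncation k x)%:E <= m%:E.
  apply: le_trans zm; apply: ge0_le_integral => //.
  - by move=> x _; rewrite lee_fin truncation_ge0.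
  - apply/measurable_EFinP; exact: measurable_truncation.
  - by move=> x _; exact: truncation_le.
have := chebyshev_iid_sum (measurable_truncation k)
  (truncation_ge0 k) tm (esym (fineK sqfin)) (expn_gt0 2 k) c0.
move=> /le_trans; apply.
under eq_integral do rewrite EFinM.
rewrite ge0_integralZl_EFin//; last 3 first.
- by move=> x _; rewrite lee_fin mulr_ge0 ?sqr_ge0 ?invr_ge0 ?exprn_ge0.
- apply/measurable_EFinP; apply: measurable_funM => //.
  by apply: measurable_funX; exact: measurable_truncation.
- by rewrite invr_ge0 exprn_ge0// ltW.
under eq_integral do rewrite EFinM.
rewrite ge0_integralZl_EFin//; last 2 first.
- by move=> x _; rewrite lee_fin sqr_ge0.
- apply/measurable_EFinP.
  by apply: measurable_funX; exact: measurable_truncation.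
rewrite -[in leRHS](fineK sqfin) -!EFinM lee_fin pN.
rewrite le_eqVlt; apply/orP; left; apply/eqP; field.
by rewrite !gt_eqF.
Qed.

(** One half of the strong law of large numbers, up to a constant factor: the
    block sums are eventually below their bound by Borel-Cantelli, and a sum of
    [n] nonnegative terms is at most that of the dyadic block just above [n],
    which at most doubles the bound. *)
Lemma ae_sum_iid_le : {ae P, forall w, \forall n \near \oo,
  \sum_(i < n) z (Xs i w) <= (2 * (m + c) * n%:R)%:E}.
Proof.
have m0 : (0 <= m)%R.
  by rewrite -lee_fin; apply: le_trans zm; exact: integral_ge0.
have : {ae P, forall w, \forall k \near \oo, ~ bad_block k w}.
  apply: ae_eventually_not; first exact: measurable_bad_block.
  apply: (@le_lt_trans _ _ (\sum_(k <oo) \int[Q]_x (block_cost k x)%:E)).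
    by apply: lee_nneseries => // k _; exact: bad_block_le.
  rewrite -integral_nneseries//; last 2 first.
  - by move=> k; apply/measurable_EFinP; exact: measurable_block_cost.
  - by move=> k x _; rewrite lee_fin block_cost_ge0.
  have C0 : (0 <= 2 + 2 * c ^- 2 :> R)%R.
    by rewrite addr_ge0// mulr_ge0// invr_ge0 exprn_ge0// ltW.
  apply: (@le_lt_trans _ _ ((2 + 2 * c ^- 2)%:E * \int[Q]_x z x)).
    rewrite -ge0_integralZl_EFin//.
    apply: ge0_le_integral => //.
    - move=> x _; apply: nneseries_ge0 => k _ _.
      by rewrite lee_fin block_cost_ge0.
    - apply: ge0_emeasurable_sum => [k x _ _|k _].
        by rewrite lee_fin block_cost_ge0.
      by apply/measurable_EFinP; exact: measurable_block_cost.
    - exact: measurable_funeM.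
    - by move=> x _; exact: sum_block_cost.
  apply: (@le_lt_trans _ _ ((2 + 2 * c ^- 2)%:E * m%:E)).
    by rewrite lee_wpmul2l.
  by rewrite -EFinM ltry.
apply: filterS => w [K _ HK].
exists (2 ^ K)%N => // n /= Kn.
have n0 : (0 < n)%N by rewrite (leq_trans _ Kn)// expn_gt0.
pose k := trunc_log 2 n.
have /andP[kn nk] : (2 ^ k <= n < 2 ^ k.+1)%N by exact: trunc_log_bounds.
have Kk : (K <= k)%N.
  by rewrite -(trunc_expnK K (isT : (1 < 2)%N)) leq_trunc_log.
apply: (@le_trans _ _ (\sum_(i < 2 ^ k.+1) z (Xs i w))).
  rewrite -(big_mkord xpredT (fun i => z (Xs i w))).
  rewrite -(big_mkord xpredT (fun i => z (Xs i w))).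
  apply: lee_sum_nneg_natr => //; exact: ltnW.
have /negP := HK _ (leqW Kk); rewrite -leNgt => /le_trans; apply.
rewrite lee_fin [leRHS]mulrAC ler_wpM2r//; first by rewrite addr_ge0// ltW.
by rewrite exprS ler_wpM2l// -natrX ler_nat.
Qed.

End dyadic_blocks.

End iid_sequence.

(** * The positive log-ratio and the Kullback-Leibler divergence *)

Section log_ratio.
Local Open Scope ereal_scope.
Context (R : realType).
Implicit Types a b eta : R.

Definition kl_term a b : \bar R := a%:E * lne (a%:E / b%:E).

(** The positive part of [ln (a / b)]. It is infinite as soon as [a] or [b]
    vanishes, so that a finite bound on it bounds [b / a] below with no
    exceptional set; where [a = 0] it is integrated with weight [a]. *)
Definition pos_log_ratio a b : \bar R :=
  if (0 < b)%R && (0 < a)%R then (Num.max 0 (ln a - ln b))%:E else +oo.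

Lemma kl_termE a b : (0 <= a)%R -> (0 <= b)%R ->
  kl_term a b = if (a <= 0)%R then 0 else if (b <= 0)%R then +oo
                else (a * (ln a - ln b))%:E.
Proof.
move=> a0 b0; rewrite /kl_term; case: ifPn => [a0'|].
  by rewrite (_ : a = 0%R) ?mul0e//; apply/eqP; rewrite eq_le a0 a0'.
rewrite -ltNge => a_gt0; case: ifPn => [b0'|].
  rewrite (_ : b = 0%R); last by apply/eqP; rewrite eq_le b0 b0'.
  by rewrite inve0 !gt0_muley// lte_fin.
rewrite -ltNge => b_gt0.
by rewrite inver gt_eqF// -EFinM lne_EFin ?divr_gt0// ln_div.
Qed.

Lemma pos_log_ratio_ge0 a b : 0 <= pos_log_ratio a b.
Proof.
by rewrite /pos_log_ratio; case: ifP => // _; rewrite lee_fin le_max lexx.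
Qed.

Lemma expR_pos_log_ratio a b : (0 <= b)%R ->
  forall y, pos_log_ratio a b = y%:E -> (expR (- y) <= b / a)%R.
Proof.
move=> b0 y; rewrite /pos_log_ratio; case: ifP => // /andP[b_gt0 a_gt0] [<-].
rewrite -[leRHS]lnK ?posrE ?divr_gt0// ler_expR ln_div ?posrE//.
by rewrite -[leRHS]opprK lerN2 opprB le_max lexx orbT.
Qed.

(** With [s = ln (a / b)], [h s = expR (- s) - 1 + s] is nonnegative and convex
    and has slope [1 - expR (- eta)] at [eta]. Hence [h] divided by that slope
    dominates [s - eta] for [s >= eta], and the positive part of [s] is at most
    [eta] plus a multiple of [h s], whose expectation is controlled by the
    Kullback-Leibler divergence. *)
Lemma pos_log_le a b eta : (0 < a)%R -> (0 < b)%R -> (0 < eta)%R ->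
  (a * Num.max 0 (ln a - ln b) <=
   eta * a + (1 - expR (- eta))^-1 * (b - a + a * (ln a - ln b)))%R.
Proof.
move=> a0 b0 eta0; set s := (ln a - ln b)%R.
have C0 : (0 < 1 - expR (- eta))%R by rewrite subr_gt0 expR_lt1 oppr_lt0.
have -> : (b = a * expR (- s))%R.
  by rewrite /s opprB expRB !lnK ?posrE//; field; rewrite gt_eqF.
have -> : (eta * a + (1 - expR (- eta))^-1 * (a * expR (- s) - a + a * s) =
  a * (eta + (1 - expR (- eta))^-1 * (expR (- s) - 1 + s)))%R by ring.
rewrite ler_pM2l//.
have h0 : (0 <= expR (- s) - 1 + s)%R by have := expR_ge1Dx (- s); lra.
have [ss|ss] := leP s eta.
  apply: (@le_trans _ _ eta); first by rewrite ge_max ss ltW.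
  by rewrite lerDl mulr_ge0// invr_ge0 ltW.
rewrite ge_max; apply/andP; split.
  by rewrite addr_ge0 ?(ltW eta0)// mulr_ge0// invr_ge0 ltW.
rewrite -lerBlDl mulrC ler_pdivlMr//.
have : (expR (- s) >= expR (- eta) * (1 - (s - eta)))%R.
  rewrite (_ : - s = - eta + - (s - eta))%R; last by ring.
  by rewrite expRD ler_wpM2l ?expR_ge0// expR_ge1Dx.
have : (expR (- eta) <= 1)%R by lra.
have := expR_gt0 (- eta).
have : (1 - eta <= expR (- eta))%R by have := expR_ge1Dx (- eta); lra.
move: C0; set E := expR (- eta); set G := expR (- s).
move=> C0 h1 h2 h3 h4; nra.
Qed.

(** The bound of [pos_log_le] with every term moved to the side where it is
    nonnegative, so that it can be integrated term by term. *)
Lemma kl_term_pos_log a b eta : (0 <= a)%R -> (0 <= b)%R -> (0 < eta)%R ->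
  a%:E * pos_log_ratio a b +
    ((1 - expR (- eta))^-1)%:E * (a%:E + maxe (- kl_term a b) 0) <=
  eta%:E * a%:E + ((1 - expR (- eta))^-1)%:E * (b%:E + maxe (kl_term a b) 0).
Proof.
move=> a0 b0 eta0; rewrite kl_termE//.
have C0 : (0 < (1 - expR (- eta))^-1)%R.
  by rewrite invr_gt0 subr_gt0 expR_lt1 oppr_lt0.
case: ifPn => [a0'|].
  have -> : a = 0%R by apply/eqP; rewrite eq_le a0 a0'.
  rewrite mul0e mule0 oppe0 maxxx !add0e adde0 mule0.
  by rewrite mule_ge0// lee_fin ltW.
rewrite -ltNge => a_gt0; case: ifPn => [b0'|].
  by rewrite [maxe +oo _]maxye addey// gt0_muley ?lte_fin// addey// leey.
rewrite -ltNge => b_gt0; rewrite /pos_log_ratio a_gt0 b_gt0/=.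
have := pos_log_le a_gt0 b_gt0 eta0.
rewrite -!EFin_max lee_fin.
set c := ((1 - _)^-1)%R; set m := Num.max 0%R _.
set k := (a * (ln a - ln b))%R => h.
have hk : (Num.max k 0 = k + Num.max (- k) 0)%R.
  by case: (leP k 0%R) => k0; case: (leP (- k)%R 0%R) => k1; lra.
by rewrite hk; move: h; lra.
Qed.

(** The divergence integral never takes the form [+oo - oo], since its negative
    part is dominated by a density. *)
Lemma kl_term_neg_le a b : (0 <= a)%R -> (0 <= b)%R ->
  maxe (- kl_term a b) 0 <= b%:E.
Proof.
move=> a0 b0; rewrite kl_termE// ge_max lee_fin b0 andbT.
case: ifPn => [_|]; first by rewrite oppe0 lee_fin.
rewrite -ltNge => a_gt0; case: ifPn => [_|]; first by rewrite leNye.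
rewrite -ltNge => b_gt0; rewrite -EFinN lee_fin.
have : (b = a * expR (- (ln a - ln b)))%R.
  by rewrite opprB expRB !lnK ?posrE//; field; rewrite gt_eqF.
have := expR_ge1Dx (- (ln a - ln b)); set s := (ln a - ln b)%R.
by move=> h ->; nra.
Qed.

End log_ratio.

(** * Exponential bounds on the evidence *)

Section model.
Local Open Scope ereal_scope.
Context (dO dT dF : measure_display).
Context (Omega : measurableType dO) (T : measurableType dT).
Context (Fam : measurableType dF) (R : realType).
Variables (lambda : {sigma_finite_measure set T -> \bar R}).
Variables (Pi : probability Fam R) (q : T -> R) (p : Fam -> T -> R).
Hypotheses (mq : measurable_fun setT q) (q0 : forall x, (0 <= q x)%R).
Hypothesis q1 : \int[lambda]_x (q x)%:E = 1.
Hypothesis mp : measurable_fun setT (fun z : T * Fam => p z.2 z.1).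
Hypothesis p0 : forall f x, (0 <= p f x)%R.
Hypothesis p1 : forall f, \int[lambda]_x (p f x)%:E = 1.
Variables (P : probability Omega R) (Xs : nat -> {RV P >-> T}).
Variable Q : probability T R.
Hypothesis law : forall i A, measurable A -> P (Xs i @^-1` A) = Q A.
Hypothesis indep : forall n (A : nat -> set T), (forall i, measurable (A i)) ->
  P [set w | forall i : 'I_n, A i (Xs i w)] = \prod_(i < n) Q (A i).
Hypothesis Qq : forall A, measurable A -> Q A = \int[lambda]_(x in A) (q x)%:E.

Lemma integral_density (g : T -> \bar R) :
  measurable_fun setT g -> (forall x, 0 <= g x) ->
  \int[Q]_x g x = \int[lambda]_x ((q x)%:E * g x).
Proof.
move=> mg g0.
rewrite (@integral_weighted _ _ _ _ R lambda Q id q 1 _ mq q0 _ g mg g0)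
  ?mul1e//.
move=> A mA; transitivity (\int[lambda]_(x in A) (q x)%:E); last first.
  by rewrite mul1e; exact/esym/Qq.
rewrite [RHS]integral_mkcond.
apply: eq_integral => x _; rewrite patchE indicE.
by case: ifPn => _; rewrite ?mule1 ?mule0.
Qed.

Definition lik_ratio n w f : R := (\prod_(i < n) (p f (Xs i w) / q (Xs i w)))%R.

Lemma lik_ratio_ge0 n w f : (0 <= lik_ratio n w f)%R.
Proof. by apply: prodr_ge0 => i _; rewrite divr_ge0. Qed.

Lemma measurable_sample i :
  measurable_fun setT (fun z : Omega * Fam => (Xs i z.1, z.2)).
Proof.
apply: measurable_fun_pair => //.
exact: (measurableT_comp (measurable_funPT (Xs i))).
Qed.

Lemma measurable_inv_q : measurable_fun setT (fun x => (q x)^-1)%R.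
Proof.
rewrite (_ : (fun _ => _) = (fun x => powR (q x) (- 1))%R).
  exact: (measurableT_comp (measurable_powR (- 1)%R) mq).
by apply/funext => x; rewrite powR_inv1.
Qed.

Lemma measurable_lik_ratio n :
  measurable_fun setT (fun z : Omega * Fam => lik_ratio n z.1 z.2).
Proof.
apply: measurable_prod => i _; apply: measurable_funM.
  exact: (measurableT_comp mp (measurable_sample i)).
apply: (measurableT_comp measurable_inv_q).
exact: (measurableT_comp (measurable_funPT (Xs i))).
Qed.

Lemma measurable_p f : measurable_fun setT (p f).
Proof. exact: (measurable_fun_pair1 f mp). Qed.

(** The expectation is [1] when [p f] vanishes wherever [q] does; mass of [p f]
    outside the support of [q] is lost. *)
Lemma expectation_lik_ratio n f : \int[P]_w (lik_ratio n w f)%:E <= 1.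
Proof.
have mpq : measurable_fun setT (fun x => p f x / q x)%R.
  apply: measurable_funM; first exact: measurable_p.
  exact: measurable_inv_q.
have pq : \int[Q]_x (p f x / q x)%:E <= 1.
  rewrite integral_density; last 2 first.
  - exact/measurable_EFinP.
  - by move=> x; rewrite lee_fin divr_ge0.
  rewrite -(p1 f); apply: ge0_le_integral => //.
  - by move=> x _; rewrite mule_ge0// lee_fin// divr_ge0.
  - by apply: emeasurable_funM; exact/measurable_EFinP.
  - by apply/measurable_EFinP; exact: measurable_p.
  - move=> x _; rewrite -EFinM lee_fin.
    have [->|qx] := eqVneq (q x) 0%R; first by rewrite mul0r.
    by rewrite mulrC divfK.
rewrite (integral_iid_prod indep n (g := fun _ x => p f x / q x)%R)//.
- have pq0 : 0 <= \int[Q]_x (p f x / q x)%:E.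
    by apply: integral_ge0 => x _; rewrite lee_fin divr_ge0.
  suff /andP[] : 0 <= \prod_(i < n) \int[Q]_x (p f x / q x)%:E <= 1 by [].
  elim/big_ind: _ => [|x y /andP[x0 x1] /andP[y0 y1]|i _].
  + by rewrite lexx lee01.
  + by rewrite mule_ge0//= -[leRHS]mule1 lee_pmul.
  + by rewrite pq0 pq.
- by move=> i x; rewrite divr_ge0.
- by move=> i; rewrite (le_lt_trans pq)// ltry.
Qed.

(** The denominator of the posterior distribution. *)
Definition evidence n w : \bar R := \int[Pi]_f (lik_ratio n w f)%:E.

Lemma evidence_ge0 n w : 0 <= evidence n w.
Proof. by apply: integral_ge0 => f _; rewrite lee_fin lik_ratio_ge0. Qed.

Lemma measurable_evidence n : measurable_fun setT (evidence n).
Proof.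
apply: (@measurable_fun_fubini_tonelli_F _ _ _ _ _ Pi
  (fun z : Omega * Fam => (lik_ratio n z.1 z.2)%:E)).
- by apply/measurable_EFinP; exact: measurable_lik_ratio.
- by move=> z; rewrite lee_fin lik_ratio_ge0.
Qed.

Lemma expectation_evidence n : \int[P]_w evidence n w <= 1.
Proof.
rewrite (fubini_tonelli (m1 := P) (m2 := Pi)
  (fun z : Omega * Fam => (lik_ratio n z.1 z.2)%:E)); last 2 first.
- by apply/measurable_EFinP; exact: measurable_lik_ratio.
- by move=> z; rewrite lee_fin lik_ratio_ge0.
apply: (@le_trans _ _ (\int[Pi]_f cst 1 f)).
  apply: ge0_le_integral => //.
  - by move=> f _; apply: integral_ge0 => w _; rewrite lee_fin lik_ratio_ge0.
  - apply: (@measurable_fun_fubini_tonelli_G _ _ _ _ _ P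
      (fun z : Omega * Fam => (lik_ratio n z.1 z.2)%:E)).
    + by apply/measurable_EFinP; exact: measurable_lik_ratio.
    + by move=> z; rewrite lee_fin lik_ratio_ge0.
  - by move=> f _; exact: expectation_lik_ratio.
rewrite integral_cst// mul1e [leLHS](_ : _ = 1)//; exact: probability_setT.
Qed.

(** Markov's inequality gives probability at most [expR (- eps * n)] to the
    complement, and Borel-Cantelli concludes. *)
Lemma ae_evidence_le (eps : R) : (0 < eps)%R ->
  {ae P, forall w, \forall n \near \oo, evidence n w <= (expR (eps * n%:R))%:E}.
Proof.
move=> eps0; pose B n := [set w | (expR (eps * n%:R))%:E < evidence n w].
have mB n : measurable (B n).
  rewrite -[B n]setTI; apply: emeasurable_fun_o_infty => //.
  exact: measurable_evidence.
have PB n : P (B n) <= (expR (- eps) ^+ n)%:E.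
  have : (expR (eps * n%:R))%:E * P (B n) <= 1.
    apply: le_trans (expectation_evidence n); apply: ge0_markov => //.
    - exact: measurable_evidence.
    - by move=> w; exact: evidence_ge0.
    - by move=> w /ltW.
  have PBfin : P (B n) \is a fin_num by exact: fin_num_measure.
  rewrite -(fineK PBfin) -EFinM !lee_fin => h.
  rewrite -expRM_natr mulNr expRN -[leRHS]mul1r ler_pdivlMr ?expR_gt0//.
  by rewrite mulrC.
suff : {ae P, forall w, \forall n \near \oo, ~ B n w}.
  apply: filterS => w; apply: filterS => n /negP.
  by rewrite -leNgt.
apply: ae_eventually_not => //.
set r := expR (- eps) in PB *.
have r1 : (0 < 1 - r)%R by rewrite subr_gt0 expR_lt1 oppr_lt0.
apply: (@le_lt_trans _ _ ((1 - r)^-1)%:E); last by rewrite ltry.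
apply: lime_le; first exact: is_cvg_nneseries.
apply: nearW => N; apply: (@le_trans _ _ (\sum_(0 <= n < N) (r ^+ n)%:E)).
  by apply: lee_sum => n _; exact: PB.
rewrite sumEFin lee_fin big_mkord -[leRHS]mul1r ler_pdivlMr// mulrC.
have := subrX1 r N; rewrite -opprB => /eqP.
rewrite -[(r - 1)%R]opprB mulNr eqr_opp.
by move/eqP => <-; rewrite lerBlDr lerDl exprn_ge0// expR_ge0.
Qed.

Definition kl_div f : \bar R := \int[lambda]_x kl_term (q x) (p f x).

(** Tonelli's theorem applies to each of the two parts, which makes the
    divergence a measurable function of [f]. *)
Lemma kl_divE f : kl_div f =
  (\int[lambda]_x maxe (kl_term (q x) (p f x)) 0) -
  \int[lambda]_x maxe (- kl_term (q x) (p f x)) 0.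
Proof. by rewrite /kl_div integralE; congr (_ - _); rewrite unlock. Qed.

Lemma measurable_q_fst : measurable_fun setT (fun z : T * Fam => q z.1).
Proof. exact: (measurableT_comp mq measurable_fst). Qed.

Lemma measurable_kl_term :
  measurable_fun setT (fun z : T * Fam => kl_term (q z.1) (p z.2 z.1)).
Proof.
under eq_fun do rewrite kl_termE//.
have mq1 := measurable_q_fst.
apply: measurable_fun_ifT => //; first exact: measurable_fun_ler.
apply: measurable_fun_ifT => //; first exact: measurable_fun_ler.
apply/measurable_EFinP; apply: measurable_funM => //.
by apply: measurable_funB; apply: measurableT_comp.
Qed.

Lemma measurable_pos_log_ratio :
  measurable_fun setT (fun z : T * Fam => pos_log_ratio (q z.1) (p z.2 z.1)).
Proof.
have mq1 := measurable_q_fst.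
apply: measurable_fun_ifT => //.
  apply: measurable_and.
    exact: (measurable_fun_ltr (f := cst (0%R : R)) _ mp).
  exact: (measurable_fun_ltr (f := cst (0%R : R)) _ mq1).
apply/measurable_EFinP; apply: measurable_maxr => //.
by apply: measurable_funB; apply: measurableT_comp.
Qed.

Lemma measurable_kl_div : measurable_fun setT kl_div.
Proof.
have mk := measurable_kl_term.
rewrite (funext kl_divE).
apply: emeasurable_funB.
- apply: (@measurable_fun_fubini_tonelli_G _ _ _ _ _ lambda
    (fun z : T * Fam => maxe (kl_term (q z.1) (p z.2 z.1)) 0)).
    exact: measurable_maxe.
  by move=> z; rewrite le_max lexx orbT.
- apply: (@measurable_fun_fubini_tonelli_G _ _ _ _ _ lambda
    (fun z : T * Fam => maxe (- kl_term (q z.1) (p z.2 z.1)) 0)).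
    by apply: measurable_maxe => //; exact: measurableT_comp.
  by move=> z; rewrite le_max lexx orbT.
Qed.

Lemma integral_pos_log_ratio_le (eta delta : R) f : (0 < eta)%R ->
  kl_div f < delta%:E ->
  \int[lambda]_x ((q x)%:E * pos_log_ratio (q x) (p f x)) <=
  (eta + (1 - expR (- eta))^-1 * delta)%:E.
Proof.
move=> eta0; set C := ((1 - _)^-1)%R.
have C0 : (0 < C)%R by rewrite invr_gt0 subr_gt0 expR_lt1 oppr_lt0.
have mk : measurable_fun setT (fun x => kl_term (q x) (p f x)).
  exact: (measurable_fun_pair1 f measurable_kl_term).
have mW : measurable_fun setT (fun x => pos_log_ratio (q x) (p f x)).
  exact: (measurable_fun_pair1 f measurable_pos_log_ratio).
have mpos : measurable_fun setT (fun x => maxe (kl_term (q x) (p f x)) 0).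
  exact: measurable_maxe.
have mneg : measurable_fun setT (fun x => maxe (- kl_term (q x) (p f x)) 0).
  by apply: measurable_maxe => //; exact: measurableT_comp.
have mqE : measurable_fun setT (fun x => (q x)%:E) by exact/measurable_EFinP.
have mpE : measurable_fun setT (fun x => (p f x)%:E).
  by apply/measurable_EFinP; exact: measurable_p.
have max0 (x : \bar R) : 0 <= maxe x 0 by rewrite le_max lexx orbT.
rewrite kl_divE.
set A := \int[lambda]_x (_ * _).
set KP := integral _ _ _; set KN := integral _ _ _.
have KN1 : KN <= 1.
  rewrite -(p1 f); apply: ge0_le_integral => //.
  by move=> x _; exact: kl_term_neg_le.
have KN0 : 0 <= KN by apply: integral_ge0 => x _; exact: max0.
have KNfin : KN \is a fin_num.
  by rewrite ge0_fin_numE// (le_lt_trans KN1)// ltry.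
rewrite lteBlDr// => KPle.
have : A + C%:E * (1 + KN) <= eta%:E + C%:E * (1 + KP).
  have n1 x : 0 <= (q x)%:E * pos_log_ratio (q x) (p f x).
    by rewrite mule_ge0 ?lee_fin// pos_log_ratio_ge0.
  have n2 x : 0 <= (q x)%:E + maxe (- kl_term (q x) (p f x)) 0.
    by rewrite adde_ge0 ?lee_fin.
  have n3 x : 0 <= (p f x)%:E + maxe (kl_term (q x) (p f x)) 0.
    by rewrite adde_ge0 ?lee_fin.
  have n2C x : 0 <= C%:E * ((q x)%:E + maxe (- kl_term (q x) (p f x)) 0).
    by rewrite mule_ge0 ?lee_fin ?(ltW C0).
  have n3C x : 0 <= C%:E * ((p f x)%:E + maxe (kl_term (q x) (p f x)) 0).
    by rewrite mule_ge0 ?lee_fin ?(ltW C0).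
  have n4 x : 0 <= eta%:E * (q x)%:E by rewrite mule_ge0 ?lee_fin// ltW.
  have qE0 x : 0 <= (q x)%:E by rewrite lee_fin.
  have pE0 x : 0 <= (p f x)%:E by rewrite lee_fin.
  have m1 := emeasurable_funM mqE mW.
  have m2 := emeasurable_funD mqE mneg.
  have m3 := emeasurable_funD mpE mpos.
  have m2C := measurable_funeM C%:E m2.
  have m3C := measurable_funeM C%:E m3.
  have m4 := measurable_funeM eta%:E mqE.
  have eA : A + C%:E * (1 + KN) = \int[lambda]_x ((q x)%:E *
      pos_log_ratio (q x) (p f x) +
      C%:E * ((q x)%:E + maxe (- kl_term (q x) (p f x)) 0)).
    rewrite ge0_integralD//; congr (_ + _).
    by rewrite ge0_integralZl_EFin ?(ltW C0)// ge0_integralD// q1.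
  have eB : eta%:E + C%:E * (1 + KP) = \int[lambda]_x (eta%:E * (q x)%:E +
      C%:E * ((p f x)%:E + maxe (kl_term (q x) (p f x)) 0)).
    rewrite ge0_integralD// !ge0_integralZl_EFin ?(ltW C0) ?(ltW eta0)//.
    by rewrite q1 mule1 ge0_integralD// p1.
  rewrite eA eB; apply: ge0_le_integral => //.
  - by move=> x _; rewrite adde_ge0.
  - exact: emeasurable_funD m1 m2C.
  - exact: emeasurable_funD m4 m3C.
  - by move=> x _; exact: kl_term_pos_log.
move=> h.
have {}h : A + C%:E * (1 + KN) <= eta%:E + C%:E * (1 + (delta%:E + KN)).
  apply: (le_trans h); rewrite leeD2l// lee_wpmul2l ?lee_fin ?(ltW C0)//.
  by rewrite leeD2l// ltW.
have [kn knE] : exists kn, KN = kn%:E by exists (fine KN); rewrite fineK.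
move: h; rewrite knE; case: A => [a|h|_]; last 2 first.
- exact: h.
- by rewrite leNye.
move=> h; have {}h : (a + C * (1 + kn) <= eta + C * (1 + (delta + kn)))%R.
  by rewrite -lee_fin; exact: h.
rewrite lee_fin -(lerD2r (C * (1 + kn))).
by apply: (le_trans h); rewrite le_eqVlt; apply/orP; left; apply/eqP; ring.
Qed.

Lemma expR_sum_pos_log_ratio n w f (y : R) :
  \sum_(i < n) pos_log_ratio (q (Xs i w)) (p f (Xs i w)) <= y%:E ->
  (expR (- y) <= lik_ratio n w f)%R.
Proof.
move=> Wy; pose W i := pos_log_ratio (q (Xs i w)) (p f (Xs i w)).
have W0 i : 0 <= W i by exact: pos_log_ratio_ge0.
have Wfin (i : 'I_n) : W i \is a fin_num.
  rewrite ge0_fin_numE//; apply: le_lt_trans (ltry y); apply: le_trans Wy.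
  by rewrite (bigD1 i)//= leeDl// sume_ge0// => j _; exact: W0.
apply: (@le_trans _ _ (expR (- \sum_(i < n) fine (W i)))).
  rewrite ler_expR lerN2 -lee_fin -sumEFin; apply: le_trans Wy.
  by apply: lee_sum => i _; rewrite fineK.
rewrite -sumrN expR_sum; apply: ler_prod => i _; rewrite expR_ge0/=.
by apply: expR_pos_log_ratio => //; rewrite fineK.
Qed.

(** Let [K] be a small divergence ball, of positive prior mass. The logarithm of
    the likelihood ratio is at least minus the sum of the positive log-ratios of
    the observations. The prior integral of that sum over [K] is a sum of iid
    nonnegative variables of small mean, hence eventually at most a small
    multiple of [n]. By Markov's inequality with respect to the prior, at least
    half of the mass of [K] then has a likelihood ratio of at least
    [expR (- y)], with [y] a small multiple of [n]. *)
Lemma ae_evidence_ge (eps : R) : (0 < eps)%R ->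
  (forall delta : R, (0 < delta)%R -> 0 < Pi [set f | kl_div f < delta%:E]) ->
  {ae P, forall w, \forall n \near \oo,
    (expR (- (eps * n%:R)))%:E <= evidence n w}.
Proof.
move=> eps0 KLs.
(* 16 eta pays for the likelihood ratios, one more eta for the prior mass. *)
pose eta := (eps / 17)%R.
have eta0 : (0 < eta)%R by rewrite divr_gt0.
have C0 : (0 < 1 - expR (- eta))%R by rewrite subr_gt0 expR_lt1 oppr_lt0.
pose delta := (eta * (1 - expR (- eta)))%R.
have delta0 : (0 < delta)%R by rewrite mulr_gt0.
set K := [set f | kl_div f < delta%:E].
have mK : measurable K.
  rewrite -[K]setTI; apply: emeasurable_fun_infty_o => //.
  exact: measurable_kl_div.
have [a Ka] : exists a, Pi K = a%:E.
  by exists (fine (Pi K)); rewrite fineK//; exact: fin_num_measure.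
have a0 : (0 < a)%R by rewrite -lte_fin -Ka; exact: KLs.
pose W x f := pos_log_ratio (q x) (p f x).
pose g (u : T * Fam) := W u.1 u.2 * (\1_K u.2)%:E.
have mg : measurable_fun setT g.
  apply: emeasurable_funM; first exact: measurable_pos_log_ratio.
  apply/measurable_EFinP.
  by apply: (measurableT_comp (f := \1_K : Fam -> R)).
have g0 u : 0 <= g u by rewrite mule_ge0// pos_log_ratio_ge0.
pose z x := \int[Pi]_f g (x, f).
have z0 x : 0 <= z x by apply: integral_ge0 => f _.
have mz : measurable_fun setT z.
  exact: (measurable_fun_fubini_tonelli_F (m2 := Pi) g).
pose m := (2 * eta * a)%R.
have m0 : (0 < m)%R by rewrite !mulr_gt0.
have zm : \int[Q]_x z x <= m%:E.
  rewrite integral_density//.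
  pose h (u : T * Fam) := (q u.1)%:E * g u.
  have mh : measurable_fun setT h.
    apply: emeasurable_funM => //; apply/measurable_EFinP.
    exact: measurable_q_fst.
  have h0 u : 0 <= h u by rewrite mule_ge0 ?lee_fin.
  have -> : \int[lambda]_x ((q x)%:E * z x) =
      \int[lambda]_x \int[Pi]_f h (x, f).
    apply: eq_integral => x _; rewrite -ge0_integralZl_EFin//.
    exact: (measurable_fun_pair2 x mg).
  rewrite (fubini_tonelli (m1 := lambda) (m2 := Pi) h)//.
  apply: (@le_trans _ _ (\int[Pi]_f ((2 * eta)%:E * (\1_K f)%:E))).
    apply: ge0_le_integral => //.
    - by move=> f _; apply: integral_ge0 => x _.
    - exact: (measurable_fun_fubini_tonelli_G (m1 := lambda) h).
    - by apply: measurable_funeM; apply/measurable_EFinP.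
    - move=> f _; rewrite /h/g/= indicE.
      have [fK|fK] := boolP (f \in K); last first.
        by rewrite integral0_eq ?mule0// => x _; rewrite !mule0.
      under eq_integral do rewrite mule1.
      rewrite mule1; move: fK; rewrite inE /K/=.
      move=> /(integral_pos_log_ratio_le eta0).
      move=> /le_trans; apply; rewrite lee_fin /delta mulrCA mulVf ?gt_eqF//.
      by rewrite mulr1 mulr_natl mulr2n.
  have mK1 : measurable_fun setT (fun f => (\1_K f)%:E : \bar R).
    by apply/measurable_EFinP; exact: measurable_indic.
  have e20 : (0 <= 2 * eta)%R by apply: mulr_ge0 => //; exact: ltW.
  rewrite ge0_integralZl_EFin//.
  by rewrite integral_indic// setIT [X in _ * X](_ : _ = a%:E)// -EFinM.
have aS := ae_sum_iid_le law indep mz z0 zm m0.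
apply: filterS aS => w aS; near=> n.
have n0 : (0 < n%:R :> R)%R.
  by rewrite ltr0n; near: n; exact: nbhs_infty_gt.
pose S f := \sum_(i < n) g (Xs i w, f).
have mS : measurable_fun setT S.
  by apply: emeasurable_sum => i; exact: (measurable_fun_pair2 (Xs i w) mg).
have S0 f : 0 <= S f by exact: sume_ge0.
have IS : \int[Pi]_f S f <= (8 * eta * a * n%:R)%:E.
  rewrite ge0_integral_sum//; last first.
    by move=> i; exact: (measurable_fun_pair2 (Xs i w) mg).
  rewrite (_ : (8 * eta * a = 2 * (m + m))%R); last by rewrite /m; ring.
  by near: n.
pose y := (16 * eta * n%:R)%R.
have y0 : (0 < y)%R by rewrite !mulr_gt0.
pose B := [set f | y%:E < S f].
have mB : measurable B.
  by rewrite -[B]setTI; exact: emeasurable_fun_o_infty.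
have [b Bb] : exists b, Pi B = b%:E.
  by exists (fine (Pi B)); rewrite fineK//; exact: fin_num_measure.
have [e De] : exists e, Pi (K `\` B) = e%:E.
  exists (fine (Pi (K `\` B))); rewrite fineK//; apply: fin_num_measure.
  exact: measurableD.
have ba : (b <= a / 2)%R.
  have : y%:E * Pi B <= \int[Pi]_f S f.
    by apply: ge0_markov => //; [exact: ltW|move=> f /ltW].
  move=> /le_trans/(_ IS); rewrite Bb lee_fin /y => hb.
  have e8 : (0 < 8 * eta * n%:R)%R by rewrite !mulr_gt0.
  rewrite ler_pdivlMr// -(ler_pM2l e8); apply: le_trans (le_trans hb _);
    by rewrite le_eqVlt; apply/orP; left; apply/eqP; ring.
have ea : (a / 2 <= e)%R.
  have : Pi K <= Pi (K `\` B) + Pi B.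
    apply: (@le_trans _ _ (Pi ((K `\` B) `|` B))).
      apply: le_measure; rewrite ?inE//.
        by apply: measurableU => //; exact: measurableD.
      by move=> f Kf; have [Bf|Bf] := pselect (B f); [right|left].
    by apply: measureU2 => //; exact: measurableD.
  by rewrite Ka De Bb lee_fin; lra.
apply: (@le_trans _ _ ((expR (- y))%:E * Pi (K `\` B))); last first.
  apply: ge0_markov => //.
  - exact: measurableD.
  - apply/measurable_EFinP.
    exact: (measurable_fun_pair2 w (measurable_lik_ratio n)).
  - by move=> f; rewrite lee_fin lik_ratio_ge0.
  - move=> f [Kf Bf]; rewrite lee_fin; apply: expR_sum_pos_log_ratio.
    move/negP : Bf; rewrite -leNgt; apply: le_trans.
    by apply: lee_sum => i _; rewrite /g/= indicE mem_set// mule1.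
rewrite De -EFinM lee_fin.
have -> : (eps = 16 * eta + eta)%R by rewrite /eta; field.
rewrite mulrDl opprD expRD -/y ler_pM2l ?expR_gt0//.
apply: le_trans ea; rewrite expRN -[leRHS]invrK.
rewrite lef_pV2 ?posrE ?expR_gt0 ?invr_gt0 ?divr_gt0//.
apply: le_trans (expR_ge1Dx _).
apply: (@le_trans _ _ (eta * n%:R)%R); last by rewrite lerDr.
rewrite -ler_pdivrMl//; near: n; exact: nbhs_infty_ger.
Unshelve. all: by end_near. Qed.

End model.

(** * Bands of the likelihood ratio *)

(** A property of intervals which passes to larger intervals and, when an
    interval is cut in two, to one of the pieces, concentrates at a point: the
    supremum of the [t] such that it fails on the interval from [alpha] to [t],
    or [alpha] if there is no such [t]. *)
Lemma concentration_point (R : realType) (H : R -> R -> Prop) (alpha beta : R) :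
  (forall a b a' b', a' <= a -> b <= b' -> H a b -> H a' b') ->
  (forall a b m, H a b -> H a m \/ H m b) ->
  alpha <= beta -> H alpha beta ->
  exists2 gamma, alpha <= gamma <= beta &
    forall r, 0 < r -> H (gamma - r) (gamma + r).
Proof.
move=> mono split ab Hab.
pose S := [set t | alpha <= t <= beta /\ ~ H alpha t].
have [[t0 St0]|S0] := pselect (S !=set0); last first.
  exists alpha => [|r r0]; first by rewrite lexx.
  have Haa : H alpha alpha.
    apply: contrapT => nH; apply: S0; exists alpha.
    by split => //; rewrite lexx.
  by apply: mono Haa; rewrite ?lerDl ?gerBl ltW.
have supS : has_sup S by split; [exists t0|exists beta => t [/andP[]]].
exists (sup S).
  apply/andP; split.
    by apply: le_trans (ub_le_sup supS.2 St0); case: St0 => /andP[].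
  by apply: ge_sup; [exists t0|move=> t [/andP[]]].
move=> r r0; have [t St tr] := sup_adherent r0 supS.
have Ha : H alpha (sup S + r).
  have [le|gt] := leP (sup S + r) beta; last exact: mono (lexx _) (ltW gt) Hab.
  apply: contrapT => nH.
  have : sup S + r <= sup S.
    apply: ub_le_sup; first exact: supS.2.
    split=> //; rewrite le andbT.
    apply: (@le_trans _ _ (sup S)); last by rewrite lerDl ltW.
    by apply: le_trans (ub_le_sup supS.2 St0); case: St0 => /andP[].
  by rewrite gerDl leNgt r0.
case: St => _ nHt; case: (split _ _ t Ha) => // Ht.
exact: mono (ltW tr) (lexx _) Ht.
Qed.

Section extended_reals.
Local Open Scope ereal_scope.
Context (R : realType).

(** The form in which a posterior mass is compared to a threshold: it removes
    the inverse and is visibly measurable. The quotient is 0 when [y] is 0 or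
    infinite. *)
Lemma lt_ratioE (x y : \bar R) (delta : R) :
  (0 < delta)%R -> 0 <= x -> x <= y ->
  (delta%:E < x / y) = (y < +oo) && (delta%:E * y < x).
Proof.
move=> d0 x0 xy; have y0 := le_trans x0 xy.
case: y => [y| |] in xy y0 *; last by [].
- rewrite ltry/=; have [y00|yn0] := eqVneq y 0%R.
    have -> : x = 0.
      by apply/eqP; rewrite eq_le x0 andbT; move: xy; rewrite y00.
    by rewrite mul0e y00 mule0 ltxx lte_fin ltNge ltW.
  have y_gt0 : (0 < y)%R by rewrite lt_neqAle eq_sym yn0 -lee_fin.
  by rewrite inver gt_eqF// lte_pdivlMr.
- by rewrite ltxx/= invey mule0 lte_fin ltNge ltW.
Qed.

Lemma le_scaled_lne (n : nat) (r m : R) : (0 < n)%N -> (0 <= m)%R ->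
  (r%:E <= (n%:R^-1)%:E * lne m%:E) = (expR (r * n%:R) <= m)%R.
Proof.
move=> n0; have n0R : (0 < n%:R :> R)%R by rewrite ltr0n.
rewrite le_eqVlt => /predU1P[<-|m0].
  rewrite le0_lneNy// gt0_muleNy ?lte_fin ?invr_gt0// leNgt ltNyr.
  by apply/esym/negbTE; rewrite -ltNge expR_gt0.
rewrite lne_EFin// -EFinM lee_fin ler_pdivlMl// -[in RHS](lnK m0) ler_expR.
by rewrite mulrC.
Qed.

Lemma ge_scaled_lne (n : nat) (r m : R) : (0 < n)%N -> (0 <= m)%R ->
  ((n%:R^-1)%:E * lne m%:E <= r%:E) = (m <= expR (r * n%:R))%R.
Proof.
move=> n0; have n0R : (0 < n%:R :> R)%R by rewrite ltr0n.
rewrite le_eqVlt => /predU1P[<-|m0].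
  by rewrite le0_lneNy// gt0_muleNy ?lte_fin ?invr_gt0// leNye expR_ge0.
rewrite lne_EFin// -EFinM lee_fin ler_pdivrMl// -[in RHS](lnK m0) ler_expR.
by rewrite mulrC.
Qed.

End extended_reals.

Section concentration.
Local Open Scope ereal_scope.
Context (dO dF : measure_display) (Omega : measurableType dO).
Context (Fam : measurableType dF) (R : realType).
Variables (Pi : probability Fam R) (P : probability Omega R).
Variable L : nat -> Omega -> Fam -> R.
Hypothesis mL : forall n,
  measurable_fun setT (fun z : Omega * Fam => L n z.1 z.2).
Hypothesis L0 : forall n w f, (0 <= L n w f)%R.
Let D n w := \int[Pi]_f (L n w f)%:E.
Hypothesis D_le : forall eps : R, (0 < eps)%R ->
  {ae P, forall w, \forall n \near \oo, D n w <= (expR (eps * n%:R))%:E}.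
Hypothesis D_ge : forall eps : R, (0 < eps)%R ->
  {ae P, forall w, \forall n \near \oo, (expR (- (eps * n%:R)))%:E <= D n w}.
Implicit Types (a b delta : R) (n : nat) (w : Omega).

Definition band a b n w : set Fam :=
  [set f | (expR (a * n%:R) <= L n w f <= expR (b * n%:R))%R].

Definition band_mass a b n w := \int[Pi]_(f in band a b n w) (L n w f)%:E.

Definition heavy a b delta n : set Omega :=
  [set w | delta%:E < band_mass a b n w / D n w].

(** Inconsistency on the band from [a] to [b]. *)
Definition heavy_io a b : Prop := exists2 delta, (0 < delta)%R &
  0 < P [set w | infinite_set [set n | heavy a b delta n w]].

Let mLw n w : measurable_fun setT (fun f => (L n w f)%:E).
Proof. by apply/measurable_EFinP; exact: (measurable_fun_pair2 w (mL n)). Qed.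

Lemma measurable_bands a b n :
  measurable [set z : Omega * Fam | band a b n z.1 z.2].
Proof.
rewrite (_ : [set _ | _] = setT `&` (fun z : Omega * Fam =>
    (expR (a * n%:R) <= L n z.1 z.2) &&
    (L n z.1 z.2 <= expR (b * n%:R)))%R @^-1` [set true]).
  have m1 := measurable_fun_ler (f := cst (expR (a * n%:R)))
    (measurable_cst _) (mL n).
  have m2 := measurable_fun_ler (mL n) (g := cst (expR (b * n%:R)))
    (measurable_cst _).
  exact: (measurable_and m1 m2).
by rewrite setTI; apply/seteqP; split.
Qed.

Lemma band_xsection a b n w :
  band a b n w = xsection [set z : Omega * Fam | band a b n z.1 z.2] w.
Proof. by rewrite xsectionE. Qed.

Lemma measurable_band a b n w : measurable (band a b n w).
Proof.
by rewrite band_xsection; apply: measurable_xsection; exact: measurable_bands.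
Qed.

Lemma measurable_prior_band a b n :
  measurable_fun setT (fun w => Pi (band a b n w)).
Proof.
under eq_fun do rewrite band_xsection.
exact: (measurable_fun_xsection Pi (measurable_bands a b n)).
Qed.

Lemma measurable_D n : measurable_fun setT (D n).
Proof.
apply: (@measurable_fun_fubini_tonelli_F _ _ _ _ _ Pi
  (fun z : Omega * Fam => (L n z.1 z.2)%:E)).
- exact/measurable_EFinP.
- by move=> z; rewrite lee_fin.
Qed.

Lemma measurable_band_mass a b n : measurable_fun setT (band_mass a b n).
Proof.
pose g (z : Omega * Fam) :=
  (L n z.1 z.2 * \1_[set z : Omega * Fam | band a b n z.1 z.2] z)%:E.
rewrite (_ : band_mass a b n = fun w => \int[Pi]_f g (w, f)).
  apply: (@measurable_fun_fubini_tonelli_F _ _ _ _ _ Pi g).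
  - apply/measurable_EFinP; apply: measurable_funM => //.
    by apply: measurable_indic; exact: measurable_bands.
  - by move=> z; rewrite lee_fin mulr_ge0.
apply/funext => w; rewrite /band_mass integral_mkcond.
apply: eq_integral => f _.
rewrite patchE /g/= indicE /=; have [fb|fb] := boolP (f \in _).
  by rewrite mem_set ?mulr1//; move: fb; rewrite inE.
by rewrite memNset ?mulr0//; move/negP : fb; rewrite inE.
Qed.

Lemma band_mass_ge0 a b n w : 0 <= band_mass a b n w.
Proof. by apply: integral_ge0 => f _; rewrite lee_fin. Qed.

Lemma band_mass_le_D a b n w : band_mass a b n w <= D n w.
Proof.
apply: ge0_subset_integral => //; first exact: measurable_band.
by move=> f _; rewrite lee_fin.
Qed.

Lemma band_mass_le a b n w :
  band_mass a b n w <= (expR (b * n%:R))%:E * Pi (band a b n w).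
Proof.
have mb := measurable_band a b n w.
rewrite -integral_cst//; apply: ge0_le_integral => //.
- by move=> f _; rewrite lee_fin.
- exact: measurable_funTS.
- by move=> f /andP[_]; rewrite lee_fin.
Qed.

Lemma band_mass_ge a b n w :
  (expR (a * n%:R))%:E * Pi (band a b n w) <= band_mass a b n w.
Proof.
have mb := measurable_band a b n w.
rewrite -integral_cst//; apply: ge0_le_integral => //.
- by move=> f _; rewrite lee_fin expR_ge0.
- exact: measurable_funTS.
- by move=> f /andP[h _]; rewrite lee_fin.
Qed.

Lemma heavyP a b delta n w : (0 < delta)%R -> heavy a b delta n w <->
  D n w < +oo /\ delta%:E * D n w < band_mass a b n w.
Proof.
move=> d0; rewrite /heavy/= lt_ratioE//; last 2 first.
- exact: band_mass_ge0.
- exact: band_mass_le_D.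
by split=> [/andP[]|[-> ->]].
Qed.

Lemma measurable_heavy a b delta n : (0 < delta)%R ->
  measurable (heavy a b delta n).
Proof.
move=> d0; rewrite (_ : heavy a b delta n = [set w | D n w < +oo] `&`
    [set w | delta%:E * D n w < band_mass a b n w]); last first.
  by apply/seteqP; split=> w /(heavyP a b n w d0).
apply: measurableI.
  rewrite -[X in measurable X]setTI; apply: emeasurable_fun_infty_o => //.
  exact: measurable_D.
rewrite -[X in measurable X]setTI; apply: measurable_lte => //.
  by apply: measurable_funeM; exact: measurable_D.
exact: measurable_band_mass.
Qed.

Lemma sub_band_mass a b a' b' n w : (a' <= a)%R -> (b <= b')%R ->
  band_mass a b n w <= band_mass a' b' n w.
Proof.
move=> aa bb; apply: ge0_subset_integral => //; try exact: measurable_band.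
- exact: measurable_funTS.
- by move=> f _; rewrite lee_fin.
- move=> f /andP[h1 h2]; apply/andP; split.
    by apply: le_trans h1; rewrite ler_expR ler_wpM2r.
  by apply: (le_trans h2); rewrite ler_expR ler_wpM2r.
Qed.

Lemma band_mass_split a b m n w :
  band_mass a b n w <= band_mass a m n w + band_mass m b n w.
Proof.
have m1 := measurable_band a m n w; have m2 := measurable_band m b n w.
pose B := band m b n w `\` band a m n w.
have mB : measurable B by exact: measurableD.
apply: (@le_trans _ _ (\int[Pi]_(f in band a m n w `|` B) (L n w f)%:E)).
  apply: ge0_subset_integral => //; first exact: measurable_band.
  - exact: measurableU.
  - exact: measurable_funTS.
  - by move=> f _; rewrite lee_fin.
  - move=> f /andP[h1 h2]; case: (leP (L n w f) (expR (m * n%:R))) => h.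
      by left; rewrite /band/= h1.
    right; split; first by rewrite /band/= h2 ltW.
    by rewrite /band/= => /andP[_]; rewrite leNgt h.
rewrite ge0_integral_setU//; last 3 first.
- exact: measurable_funTS.
- by move=> f _; rewrite lee_fin.
- by rewrite disj_set2E; apply/eqP; rewrite /B setDE setICA setICr setI0.
apply: leeD2l; apply: ge0_subset_integral => //.
- exact: measurable_funTS.
- by move=> f _; rewrite lee_fin.
- exact: subDsetl.
Qed.

Lemma heavy_ioE a b delta :
  [set w | infinite_set [set n | heavy a b delta n w]] =
  lim_sup_set (heavy a b delta).
Proof. exact: infinitely_oftenE. Qed.

Lemma heavy_io_mono a b a' b' : (a' <= a)%R -> (b <= b')%R ->
  heavy_io a b -> heavy_io a' b'.
Proof.
move=> aa bb [delta d0 H]; exists delta; first exact: d0.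
rewrite heavy_ioE; rewrite heavy_ioE in H.
apply: (lt_le_trans H); apply: le_measure; rewrite ?inE.
- by apply: measurable_lim_sup_set => n; exact: measurable_heavy.
- by apply: measurable_lim_sup_set => n; exact: measurable_heavy.
- apply: sub_lim_sup_set => n w /(heavyP a b n w d0)[Dfin h].
  apply/(heavyP a' b' n w d0); split; first exact: Dfin.
  exact: (lt_le_trans h (sub_band_mass n w aa bb)).
Qed.

(** If the posterior gives the band more than [delta], it gives one of the two
    pieces more than [delta / 2]; one piece must then serve for infinitely many
    [n], with positive probability. *)
Lemma heavy_io_split a b m : heavy_io a b -> heavy_io a m \/ heavy_io m b.
Proof.
move=> [delta d0 H]; rewrite heavy_ioE in H.
have d20 : (0 < delta / 2)%R by rewrite divr_gt0.
pose I1 := lim_sup_set (heavy a m (delta / 2)).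
pose I2 := lim_sup_set (heavy m b (delta / 2)).
have mI1 : measurable I1.
  by apply: measurable_lim_sup_set => n; exact: measurable_heavy.
have mI2 : measurable I2.
  by apply: measurable_lim_sup_set => n; exact: measurable_heavy.
have : 0 < P I1 + P I2.
  apply: (lt_le_trans H); apply: le_trans (measureU2 P mI1 mI2).
  apply: le_measure; rewrite ?inE.
  - by apply: measurable_lim_sup_set => n; exact: measurable_heavy.
  - exact: (measurableU _ _ mI1 mI2).
  apply: lim_sup_setU_sub => n w /(heavyP a b n w d0)[Dfin h].
  have [h1|h1] := ltP ((delta / 2)%:E * D n w) (band_mass a m n w).
    by left; apply/(heavyP a m n w d20).
  have [h2|h2] := ltP ((delta / 2)%:E * D n w) (band_mass m b n w).
    by right; apply/(heavyP m b n w d20).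
  move: h; rewrite ltNge => /negP; case.
  apply: (le_trans (band_mass_split a b m n w)); apply: (le_trans (leeD h1 h2)).
  by rewrite -ge0_muleDl ?lee_fin ?(ltW d20)// -EFinD -splitr.
move=> P12; have [P1|P1] := ltP 0 (P I1).
  by left; exists (delta / 2)%R; [exact: d20|rewrite heavy_ioE; exact: P1].
right; exists (delta / 2)%R; [exact: d20|rewrite heavy_ioE].
rewrite ltNge; apply/negP => P2; move: P12; rewrite ltNge => /negP; apply.
exact: adde_le0 P1 P2.
Qed.

(** The event in the conclusion of the theorem. For [n > 0] it amounts to the
    two exponential bounds of [mass_bounds], which are visibly measurable. *)
Definition pinned a b (tau1 tau2 : R) n : set Omega :=
  [set w | (a - tau1)%:E <= - ((n%:R^-1)%:E * lne (Pi [set f |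
     a%:E <= (n%:R^-1)%:E * lne (L n w f)%:E <= b%:E])) <= (b + tau2)%:E].

Lemma band_lne a b n w : (0 < n)%N ->
  [set f | a%:E <= (n%:R^-1)%:E * lne (L n w f)%:E <= b%:E] = band a b n w.
Proof.
move=> n0; apply/seteqP.
by split=> f; rewrite /band/= le_scaled_lne// ge_scaled_lne.
Qed.

Definition mass_bounds a b (tau1 tau2 : R) n : set Omega :=
  [set w | (expR (- (b + tau2) * n%:R))%:E <= Pi (band a b n w)] `&`
  [set w | Pi (band a b n w) <= (expR (- (a - tau1) * n%:R))%:E].

Lemma pinnedE a b tau1 tau2 n : (0 < n)%N ->
  pinned a b tau1 tau2 n = mass_bounds a b tau1 tau2 n.
Proof.
move=> n0; apply/seteqP.
suff H w : (pinned a b tau1 tau2 n w : Prop) <-> mass_bounds a b tau1 tau2 n w.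
  by split=> w /H.
rewrite /pinned /mass_bounds /setI /= band_lne//.
have mb := measurable_band a b n w.
have [m Pm] : exists m, Pi (band a b n w) = m%:E.
  by exists (fine (Pi (band a b n w))); rewrite fineK//; exact: fin_num_measure.
have m0 : (0 <= m)%R by rewrite -lee_fin -Pm.
rewrite Pm leeNr leeNl -!EFinN ge_scaled_lne// le_scaled_lne//.
by rewrite !lee_fin andbC; split => [/andP[]|[-> ->]].
Qed.

Lemma measurable_mass_bounds a b tau1 tau2 n :
  measurable (mass_bounds a b tau1 tau2 n).
Proof.
have mP := measurable_prior_band a b n.
by apply: measurableI; rewrite -[X in measurable X]setTI;
  [exact: emeasurable_fun_c_infty|exact: emeasurable_fun_infty_c].
Qed.

Lemma lim_sup_pinned a b tau1 tau2 :
  lim_sup_set (pinned a b tau1 tau2) = lim_sup_set (mass_bounds a b tau1 tau2).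
Proof.
by apply/seteqP; split=> w /lim_sup_setP H; apply/lim_sup_setP => n;
  have [k nk Hk] := H n.+1; exists k; rewrite ?(ltnW nk)//; move: Hk;
  rewrite pinnedE// (leq_ltn_trans _ nk).
Qed.

(** On the band, the likelihood ratio is between [expR (a * n)] and
    [expR (b * n)]. Hence, up to these factors, the prior mass of the band is
    its posterior mass times the evidence. The posterior mass is between [delta]
    and [1], and the evidence is subexponential. *)
Lemma heavy_io_pinned a b (tau1 tau2 : R) : (0 < tau1)%R -> (0 < tau2)%R ->
  heavy_io a b ->
  0 < P [set w | infinite_set [set n | pinned a b tau1 tau2 n w]].
Proof.
move=> t1 t2 [delta d0].
rewrite heavy_ioE infinitely_oftenE lim_sup_pinned => H.
have t22 : (0 < tau2 / 2)%R by rewrite divr_gt0.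
have [N [mN PN0 subN]] : {ae P, forall w, \forall n \near \oo,
    D n w <= (expR (tau1 * n%:R))%:E /\
    (expR (- (tau2 / 2 * n%:R)))%:E <= D n w}.
  apply: filterS2 (D_le t1) (D_ge t22) => w; exact: filterS2.
have mI : measurable (lim_sup_set (heavy a b delta)).
  by apply: measurable_lim_sup_set => n; exact: measurable_heavy.
have mJ : measurable (lim_sup_set (mass_bounds a b tau1 tau2)).
  by apply: measurable_lim_sup_set => n; exact: measurable_mass_bounds.
rewrite -[ltRHS]adde0 -[X in _ + X]PN0.
apply: (lt_le_trans H); apply: le_trans (measureU2 P mJ mN).
apply: le_measure; rewrite ?inE; [exact: mI|exact: (measurableU _ _ mJ mN)|].
move=> w /lim_sup_setP Hw.
have [Nw|Nw] := pselect (N w); [by right|left].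
have Dw : \forall n \near \oo,
    D n w <= (expR (tau1 * n%:R))%:E /\
    (expR (- (tau2 / 2 * n%:R)))%:E <= D n w.
  by apply: contrapT => nD; apply: Nw; exact: subN.
(* Half of [tau2] pays for the evidence, the other half for [delta]. *)
have dw : \forall n \near \oo, (expR (- (tau2 / 2 * n%:R)) <= delta)%R.
  near=> n; rewrite expRN -[leRHS]invrK lef_pV2 ?posrE ?expR_gt0 ?invr_gt0//.
  apply: le_trans (expR_ge1Dx _).
  apply: (@le_trans _ _ (tau2 / 2 * n%:R)%R); last by rewrite lerDr.
  by rewrite -ler_pdivrMl//; near: n; exact: nbhs_infty_ger.
have [M _ HM] := filterI Dw dw.
apply/lim_sup_setP => n; have [k] := Hw (maxn n M).
rewrite geq_max => /andP[nk Mk] /(heavyP a b k w d0)[_ hk].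
exists k => //; have [[Dle Dge] dk] := HM k Mk.
have mb := measurable_band a b k w.
have [m Pm] : exists m, Pi (band a b k w) = m%:E.
  by exists (fine (Pi (band a b k w))); rewrite fineK//; exact: fin_num_measure.
have B1 := band_mass_ge a b k w; have B2 := band_mass_le a b k w.
rewrite Pm in B1 B2; rewrite /mass_bounds /setI/= Pm; split.
- have : delta%:E * (expR (- (tau2 / 2 * k%:R)))%:E <=
      (expR (b * k%:R))%:E * m%:E.
    apply: le_trans B2; apply: le_trans (ltW hk).
    by rewrite lee_wpmul2l// lee_fin ltW.
  rewrite -!EFinM !lee_fin => h.
  rewrite -(ler_pM2l (expR_gt0 (b * k%:R))); apply: le_trans h.
  apply: (@le_trans _ _ (expR (- (tau2 / 2 * k%:R)) *
      expR (- (tau2 / 2 * k%:R))))%R.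
    by rewrite -!expRD ler_expR le_eqVlt; apply/orP; left; apply/eqP; field.
  by rewrite ler_wpM2r// expR_ge0.
- have := le_trans B1 (le_trans (band_mass_le_D a b k w) Dle).
  rewrite -EFinM !lee_fin => h.
  rewrite -(ler_pM2l (expR_gt0 (a * k%:R))); apply: (le_trans h).
  by rewrite -expRD ler_expR le_eqVlt; apply/orP; left; apply/eqP; ring.
Unshelve. all: by end_near. Qed.

End concentration.

(** * The rate of inconsistency *)

Lemma mutually_independent_prefix (R : realType) (X : pmetricType R)
    (d : measure_display) (Omega : measurableType d) (P : probability Omega R)
    (Xs : nat -> {RV P >-> borel X}) : mutually_independent Xs ->
  forall n (A : nat -> set (borel X)), (forall i, measurable (A i)) ->
  P [set w | forall i : 'I_n, A i (Xs i w)] =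
  (\prod_(i < n) P (Xs i @^-1` A i))%E.
Proof.
move=> ind n A mA; pose J := [fset i in iota 0 n]%fset.
have := ind J A mA.
rewrite (perm_big (iota 0 n)) /=; last first.
  by apply: uniq_perm; rewrite ?fset_uniq ?iota_uniq// => i; rewrite !inE.
rewrite -[in iota 0 n](subn0 n) -/(index_iota 0 n) big_mkord => <-; congr (P _).
apply/seteqP; split=> w /= h.
  by move=> i /=; rewrite !inE mem_iota/= => ni; exact: (h (Ordinal ni)).
by move=> i; apply: h; rewrite /= !inE mem_iota/=.
Qed.

Theorem theorem4 (R : realType) (X : pmetricType R) (hX : separable X)
  (lambda : {sigma_finite_measure set (borel X) -> \bar R})
  (F : set (X -> R)) (hF : F `<=` [set f | prob_density lambda f])
  (fstar : set_type F)
  (hmeas : jointly_measurable lambda fstar)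
  (Pi : probability (weak_borel lambda fstar) R)
  (d : measure_display) (Omega : measurableType d)
  (P : probability Omega R) (Xs : nat -> {RV P >-> borel X})
  (hXs : iid_with_density Xs lambda (sval fstar))
  (alpha beta : R) (alpha_gt0 : 0 < alpha) (alpha_lt_beta : alpha < beta) :
  KL_support Pi ->
  inconsistent Pi Xs alpha beta ->
  exists2 gamma : R, alpha <= gamma <= beta &
  \forall chi \near 0^'+,
  exists mu1 mu2 : R, [/\ 0 <= mu1, 0 <= mu2, mu1 + mu2 <= chi &
  forall tau1 tau2 : R, 0 < tau1 -> 0 < tau2 ->
  (0 < P [set w | infinite_set [set n : nat |
     (gamma - mu1 - tau1)%:E <=
     - ((n%:R^-1)%:E *
        lne (Pi [set f | (gamma - mu1)%:E <=
                         (n%:R^-1)%:E *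
                         lne (likelihood_ratio (fun i => Xs i w) n f)%:E <=
                         (gamma + mu2)%:E]))
     <= (gamma + mu2 + tau2)%:E]])%E].
Proof.
move=> KLs incons.
have [ind law_density] := hXs.
pose q : borel X -> R := sval fstar.
pose p (f : weak_borel lambda fstar) : borel X -> R :=
  @density_of R X F fstar f.
have dens (f : set_type F) : prob_density lambda (sval f).
  by apply: hF; exact: set_valP.
have [mq q0 q1] := dens fstar.
have p0 f x : 0 <= p f x by have [_ + _] := dens f; apply.
have p1 f : (\int[lambda]_x (p f x)%:E = 1)%E by have [_ _] := dens f.
pose Q : probability (borel X) R := distribution P (Xs 0).
have law i A : measurable A -> P (Xs i @^-1` A) = Q A.
  move=> mA.
  exact: etrans (law_density i A mA) (esym (law_density 0%N A mA)).
have indep n (A : nat -> set (borel X)) : (forall i, measurable (A i)) ->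
    P [set w | forall i : 'I_n, A i (Xs i w)] = (\prod_(i < n) Q (A i))%E.
  move=> mA; apply: etrans (mutually_independent_prefix ind n mA) _.
  by apply: eq_bigr => i _; exact: law.
have Qq A : measurable A -> Q A = (\int[lambda]_(x in A) (q x)%:E)%E.
  exact: law_density.
have D_le (eps : R) (eps0 : 0 < eps) :=
  ae_evidence_le Pi mq q0 hmeas p0 p1 indep Qq eps0.
have D_ge (eps : R) (eps0 : 0 < eps) :=
  ae_evidence_ge mq q0 q1 hmeas p0 p1 law indep Qq eps0 KLs.
have mL := measurable_lik_ratio mq q0 hmeas Xs.
have L0 := lik_ratio_ge0 (T := borel X) (q := q) (p := p) q0 p0 Xs.
have [gamma gab Hgamma] := concentration_point
  (@heavy_io_mono _ _ _ _ _ Pi P _ mL L0)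
  (@heavy_io_split _ _ _ _ _ Pi P _ mL L0) (ltW alpha_lt_beta) incons.
exists gamma => //; near=> chi.
exists (chi / 2), (chi / 2); split.
- by rewrite divr_ge0.
- by rewrite divr_ge0.
- by rewrite -splitr.
move=> tau1 tau2 t1 t2.
have chi20 : 0 < chi / 2 by rewrite divr_gt0.
exact: (heavy_io_pinned mL L0 D_le D_ge t1 t2 (Hgamma _ chi20)).
Unshelve. all: by end_near. Qed.
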